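(* Let $A$ be a nonempty set. For every $d\in\mathbb{N}$ let $g_d\colon\mathbb{R}^d\times A\to\mathbb{R}$ be $(\mathcal{B}(\mathbb{R}^d)\otimes 2^A)/\mathcal{B}(\mathbb{R})$-measurable, and assume $\sup_{d\in\mathbb{N}}\sup_{x\in\mathbb{R}^d}\sup_{a\in A}|g_d(x,a)|<\infty$. Let $(\Omega,\mathcal{F},\mathbb{P})$ be a probability space, let $\Theta=\bigcup_{n\in\mathbb{N}}\mathbb{Z}^n$, for every $d\in\mathbb{N}$ let $\mathcal{F}_d^\theta\subseteq\mathcal{F}$, $\theta\in\Theta$, be independent sub-$\sigma$-algebras of $\mathcal{F}$, and for every $d\in\mathbb{N}$ let $X_d^\theta=(X_d^{\theta,x,a}(\omega))_{(x,a,\omega)\in\mathbb{R}^d\times A\times\Omega}\colon\mathbb{R}^d\times A\times\Omega\to\mathbb{R}^d$, $\theta\in\Theta$, be i.i.d. random fields which satisfy for all $d\in\mathbb{N}$, $\theta\in\Theta$ that $X_d^\theta$ is $(\mathcal{B}(\mathbb{R}^d)\otimes 2^A\otimes\mathcal{F}_d^\theta)/\mathcal{B}(\mathbb{R}^d)$-measurable. For every $d\in\mathbb{N}$ let $\delta_d\in[0,1)$, $\mathcal{R}_d\in[0,\infty)$. Let $M\in\mathbb{N}\cap[\sup_{d\in\mathbb{N}}(4|A|^2(1-\delta_d)^{-2}),\infty]$. For every $d\in\mathbb{N}$ let $\mathcal{Q}_{d,n}^\theta\colon\mathbb{R}^d\times A\times\Omega\to\mathbb{R}$, $n\in\mathbb{N}_0$,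 $\theta\in\Theta$, satisfy for all $n\in\mathbb{N}_0$, $\theta\in\Theta$, $x\in\mathbb{R}^d$, $a\in A$ that $$\mathcal{Q}_{d,n}^\theta(x,a)=g_d(x,a)+\sum_{l=0}^{n-1}\frac{\delta_d}{M^{n-l}}\sum_{i=1}^{M^{n-l}}\Big[\max_{b\in A}\big\{\mathcal{Q}_{d,l}^{(\theta,l,i)}(X_d^{(\theta,l,i),x,a},b)\big\}-\mathbf{1}_{\mathbb{N}}(l)\max_{b\in A}\big\{\mathcal{Q}_{d,\max\{l-1,0\}}^{(\theta,-l,i)}(X_d^{(\theta,l,i),x,a},b)\big\}\Big],$$ and for every $d\in\mathbb{N}$ let $\mathcal{C}_{d,n}\in[0,\infty)$, $n\in\mathbb{N}_0$, satisfy for all $n\in\mathbb{N}_0$ that $$\mathcal{C}_{d,n}\le\sum_{l=0}^{n-1}M^{n-l}\big(\mathcal{R}_d+\mathcal{C}_{d,l}+\mathcal{C}_{d,\max\{l-1,0\}}\mathbf{1}_{\mathbb{N}}(l)\big).$$ Then: (i) for all $d\in\mathbb{N}$ there exists a unique bounded $(\mathcal{B}(\mathbb{R}^d)\otimes 2^A)/\mathcal{B}(\mathbb{R})$-measurable $Q_d\colon\mathbb{R}^d\times A\to\mathbb{R}$ which satisfies for all $x\in\mathbb{R}^d$, $a\in A$ that $$Q_d(x,a)=g_d(x,a)+\delta_d\,\mathbb{E}\Big[\max_{b\in A}Q_d(X_d^{0,x,a},b)\Big];$$ (ii) there exist $N\colon(0,1]\to\mathbb{N}$ and $c\in\mathbb{R}$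 such that for all $d\in\mathbb{N}$, $\varepsilon\in(0,1]$ it holds that $\mathcal{C}_{d,N_\varepsilon}\le c\,\mathcal{R}_d\,\varepsilon^{-c}$ and $$\sup_{x\in\mathbb{R}^d}\Big(\mathbb{E}\Big[\max_{a\in A}|Q_d(x,a)-\mathcal{Q}_{d,N_\varepsilon}^0(x,a)|^2\Big]\Big)^{1/2}\le\varepsilon.$$
   Context: $\mathbb{N}=\{1,2,3,\dots\}$, $\mathbb{N}_0=\mathbb{N}\cup\{0\}$; $2^A$ is the power set of $A$; $|A|$ is the cardinality of $A$; $\mathbf{1}_{\mathbb{N}}$ is the indicator function of $\mathbb{N}$. Indices in $\Theta$ are concatenated: for $\theta\in\mathbb{Z}^k$ and $l,i\in\mathbb{Z}$, $(\theta,l,i)\in\mathbb{Z}^{k+2}\subseteq\Theta$; the index $0$ is $0\in\mathbb{Z}^1\subseteq\Theta$. The argument $\omega$ is suppressed: $\mathcal{Q}_{d,l}^{\eta}(X_d^{\vartheta,x,a},b)$ denotes $\omega\mapsto\mathcal{Q}_{d,l}^{\eta}(X_d^{\vartheta,x,a}(\omega),b,\omega)$. Since $M\in\mathbb{N}$ is finite, the condition on $M$ entails that $A$ is finite and $\sup_{d}\delta_d<1$. $N_\varepsilon$ denotes $N(\varepsilon)$. Empty sums are $0$. *)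

(* Defs.v *)
From HB Require Import structures.
From mathcomp Require Import all_boot all_order all_algebra.
From mathcomp Require Import all_classical all_reals all_analysis.

Set Implicit Arguments.
Unset Strict Implicit.
Unset Printing Implicit Defensive.

Import Order.TTheory GRing.Theory Num.Theory.
Import numFieldNormedType.Exports.

Local Open Scope classical_set_scope.
Local Open Scope ring_scope.

(* The nonempty integer sequences, i.e. the disjoint union of the Z^n, n >= 1. *)
Definition Theta : choiceType := {s : seq int | s != [::]}.

Lemma cat2_neq_nil (s : seq int) (l i : int) : s ++ [:: l; i] != [::].
Proof. by case: s. Qed.

Definition Theta0 : Theta := exist _ [:: 0%Z] isT.

Definition Theta_cat (theta : Theta) (l i : int) : Theta :=
  exist _ (val theta ++ [:: l; i]) (cat2_neq_nil (val theta) l i).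

Notation borel_rV R d := (g_sigma_algebraType (@open 'rV[R]_d)).
Notation discrete A := (g_sigma_algebraType [set: set A]).

Definition measurable_field {R : realType} {A : pointedType} {d : nat}
    (f : 'rV[R]_d -> A -> R) : Prop :=
  measurable_fun [set: borel_rV R d * discrete A]
    (fun p : borel_rV R d * discrete A => f p.1 p.2).

(* The greatest value of [f] if there is one (always so when [A] is finite and
   nonempty); the default 0 is only reached when the maximum does not exist. *)
Definition maxval {R : realType} {A : Type} (f : A -> R) : R :=
  xget 0 (range f `&` ubound (range f)).

Definition sub_sigma {disp : measure_display} {Omega : measurableType disp}
    (G : set (set Omega)) : Prop :=
  sigma_algebra [set: Omega] G /\ G `<=` measurable.

(* Mutual independence of a family of systems of events: the product rule holds
   over every finite subfamily. *)
Definition independent {disp : measure_display} {Omega : measurableType disp}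
    {R : realType} (P : probability Omega R) {I : choiceType}
    (G : I -> set (set Omega)) : Prop :=
  forall (s : seq I) (E : I -> set Omega), uniq s ->
    (forall i, i \in s -> G i (E i)) ->
    P (\bigcap_(i in [set` s]) E i) = (\prod_(i <- s) P (E i))%E.

(* The product sigma-algebra on [J -> E]. A random field is regarded as a random
   element of [J -> E], its law being a measure on this sigma-algebra. *)
Definition product_sigma (J : Type) {disp : measure_display}
    (E : measurableType disp) : set (set (J -> E)) :=
  <<s \bigcup_(j in [set: J])
        preimage_set_system [set: J -> E] (fun f => f j) measurable >>.
Arguments product_sigma J {disp} E _.

Definition iid_fields {disp : measure_display} {Omega : measurableType disp}
    {R : realType} (P : probability Omega R) {I : choiceType} {J : Type}
    {dispE : measure_display} {E : measurableType dispE}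
    (X : I -> Omega -> (J -> E)) : Prop :=
  independent P
    (fun i => preimage_set_system [set: Omega] (X i) (product_sigma J E)) /\
  (forall (i i' : I) (B : set (J -> E)), product_sigma J E B ->
    P (X i @^-1` B) = P (X i' @^-1` B)).

Definition bellman_solution {disp : measure_display}
    {Omega : measurableType disp} {R : realType} (P : probability Omega R)
    {A : pointedType} {d : nat} (g : 'rV[R]_d -> A -> R) (delta : R)
    (X0 : 'rV[R]_d -> A -> Omega -> 'rV[R]_d) (Q : 'rV[R]_d -> A -> R) : Prop :=
  [/\ measurable_field Q,
      exists K : R, forall x a, `|Q x a| <= K &
      forall x a, (Q x a)%:E =
        ((g x a)%:E
         + delta%:E * 'E_P[fun w => maxval (fun b => Q (X0 x a w) b)])%E].

(* Main.v *)
Require Import Defs.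
From HB Require Import structures.
From mathcomp Require Import all_boot all_order all_algebra.
From mathcomp Require Import all_classical all_reals all_analysis.
From mathcomp Require Import measurable_realfun.
From mathcomp Require Import ring lra.

Set Implicit Arguments.
Unset Strict Implicit.
Unset Printing Implicit Defensive.

Import Order.TTheory GRing.Theory Num.Theory.
Import numFieldNormedType.Exports.

Local Open Scope classical_set_scope.
Local Open Scope ring_scope.

(** The scheme is a multilevel Monte Carlo version of Picard iteration for the
    Bellman equation Q = g + delta E[max Q(X, b)], whose right-hand side is a
    contraction of ratio delta in the supremum norm. Contraction gives existence,
    uniqueness, and the bound |Q| <= G / (1 - delta) ([bellman_exists],
    [bellman_unique], [bellman_bound]).

    For the error, split Q_n - Q into the deviation of Q_n from its mean and the
    bias of the mean. In the mean the level corrections telescope ([Ex_q]): E Q_n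
    is one exact Bellman step applied to Q_(n-1), so the bias is at most delta
    times the previous error. The corrections that make up Q_n are independent across
    the pairs (l, i), so variances add, and a correction at level l has second
    moment at most (e_l + e_(l-1))^2 and is averaged over M^(n-l) copies. With
    r = 1/M this gives, for the worst L2 errors e_n,
      e_n <= delta e_(n-1)
             + delta (|A| sum_(l < n) r^(n-l) (e_l + e_(l-1))^2)^(1/2),
    where e_(-1) stands for a bound on g. Put u = |A| / sqrt M. The condition on M
    says that 2 u <= 1 - delta, and e_n <= E beta^n with beta = 1 - u^2 is then
    stable under the recursion because
      (1 - 2 u) (1 + 2 u / (1 - u)) <= (1 + u) (1 - u) = beta.
    Neither E nor beta depends on the dimension ([scheme_error]). The cost grows at
    most like (3 M)^n ([cost_le]), and E beta^n <= eps already at a level logarithmic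
    in 1/eps, so the cost is a power of 1/eps ([level_choice]).

    Two points need care. Q_l is evaluated at the random point X, so every use
    of independence must allow a jointly measurable field to be frozen at an
    independent random argument: [Ex_decouple] replaces E H(w, w) by
    E_w1 E_w2 H(w1, w2) when the two arguments are read through independent
    sigma-algebras, which are obtained by pooling disjoint families of the given
    ones ([pooled_indep]). And telescoping requires the law of the field
    Q_l^theta on the path space to be the same for all theta ([q_law]). Joint laws
    are transported through sums and through random evaluation by one general
    lemma, [same_law_mix]: after decoupling, one argument can be replaced at a time
    while the other is frozen. *)

(** * Greatest values over a finite set of actions *)

Section Maxval.
Context {R : realType} {A : pointedType}.
Hypothesis finA : finite_set [set: A].
Implicit Types f h : A -> R.

Lemma maxval_attained f :
  exists a, maxval f = f a /\ forall b, f b <= maxval f.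
Proof.
have [s sA] : exists s : seq A, forall b : A, b \in s.
  have [s sE] := (finite_seqP _).1 finA.
  by exists s => b; have : [set: A] b by []; rewrite sE.
have [a aP] : exists a, forall b, f b <= f a.
  have [a aP] : exists a, forall b, b \in s -> f b <= f a.
    elim: s {sA} => [|c s [a aP]]; first by exists point.
    have [fca|/ltW fac] := leP (f c) (f a).
      by exists a => b; rewrite inE => /predU1P[->//|/aP].
    by exists c => b; rewrite inE => /predU1P[->//|/aP/le_trans]; apply.
  by exists a => b; exact: aP.
have fmax : (range f `&` ubound (range f)) (f a).
  by split; [exists a|move=> _ [b _ <-]; exact: aP].
have [[b _ fb] ub] : (range f `&` ubound (range f)) (maxval f).
  exact: (xgetI 0 fmax).
by exists b; split => // c; apply: ub; exists c.
Qed.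

Lemma maxval_ge f b : f b <= maxval f.
Proof. by have [a [_]] := maxval_attained f; apply. Qed.

Lemma maxval_le f c : (forall b, f b <= c) -> maxval f <= c.
Proof. by move=> fc; have [a [-> _]] := maxval_attained f. Qed.

Lemma maxval_cst c : maxval (fun _ : A => c) = c :> R.
Proof. by have [a [-> _]] := maxval_attained (fun=> c). Qed.

Lemma maxval_norm_le f K : (forall b, `|f b| <= K) -> `|maxval f| <= K.
Proof. by move=> fK; have [a [-> _]] := maxval_attained f. Qed.

Lemma maxval_dist f h :
  `|maxval f - maxval h| <= maxval (fun b => `|f b - h b|).
Proof.
wlog le_hf : f h / maxval h <= maxval f.
  move=> hwlog; have [|/ltW] := leP (maxval h) (maxval f); first exact: hwlog.
  move/hwlog; rewrite distrC => /le_trans; apply.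
  by apply: maxval_le => b; rewrite distrC; exact: (maxval_ge (fun b => `|f b - h b|)).
rewrite ger0_norm ?subr_ge0//.
have [a [fa _]] := maxval_attained f.
apply: le_trans (maxval_ge (fun b => `|f b - h b|) a).
by apply: le_trans (ler_norm _); rewrite fa lerB// maxval_ge.
Qed.

Lemma measurable_maxval d (T : measurableType d) (F : A -> T -> R) :
  (forall b, measurable_fun [set: T] (F b)) ->
  measurable_fun [set: T] (fun t => maxval (F ^~ t)).
Proof.
move=> mF.
have [s sE] := (finite_seqP _).1 finA.
have sA b : b \in s by have : [set: A] b by []; rewrite sE.
have -> : (fun t => maxval (F ^~ t)) =
    (fun t => foldr (fun b m => Num.max (F b t) m) (F point t) s).
  apply/funext => t; apply/eqP; rewrite eq_le; apply/andP; split.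
    apply: maxval_le => b.
    move: (sA b); elim: s {sE sA} => //= c s IH; rewrite inE le_max => /predU1P[->|/IH->].
      by rewrite lexx.
    by rewrite orbT.
  by elim: s {sE sA} => [|c s IH] /=; rewrite ?ge_max ?IH ?andbT; exact: (maxval_ge (F ^~ t)).
elim: s {sE sA} => [|c s IH] /=; first exact: mF.
exact: measurable_maxr.
Qed.

End Maxval.

(** * Expectations of bounded random variables *)

Section BoundedExpectation.
Context {d} {T : measurableType d} {R : realType}.
Implicit Types f h : T -> R.

(** Boundedness is part of the class because every random variable below is bounded:
    integrability then never has to be discussed. *)
Definition bounded_mfun f :=
  measurable_fun [set: T] f /\ exists K, forall w, `|f w| <= K.

Lemma bounded_mfun_cst c : bounded_mfun (fun=> c).
Proof. by split; [exact: measurable_cst|exists `|c|]. Qed.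

Lemma bounded_mfunD f h : bounded_mfun f -> bounded_mfun h ->
  bounded_mfun (fun w => f w + h w).
Proof.
move=> [mf [K fK]] [mh [L hL]]; split; first exact: measurable_funD.
by exists (K + L) => w; rewrite (le_trans (ler_normD _ _))// lerD.
Qed.

Lemma bounded_mfunM f h : bounded_mfun f -> bounded_mfun h ->
  bounded_mfun (fun w => f w * h w).
Proof.
move=> [mf [K fK]] [mh [L hL]]; split; first exact: measurable_funM.
by exists (K * L) => w; rewrite normrM ler_pM.
Qed.

Lemma bounded_mfunZ c f : bounded_mfun f -> bounded_mfun (fun w => c * f w).
Proof. exact/bounded_mfunM/bounded_mfun_cst. Qed.

Lemma bounded_mfunB f h : bounded_mfun f -> bounded_mfun h ->
  bounded_mfun (fun w => f w - h w).
Proof.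
move=> bf bh; have := bounded_mfunD bf (bounded_mfunZ (-1) bh).
by under eq_fun do rewrite mulN1r.
Qed.

Lemma bounded_mfun_sqr f : bounded_mfun f -> bounded_mfun (fun w => f w ^+ 2).
Proof. by move=> bf; exact: bounded_mfunM. Qed.

Lemma bounded_mfun_norm f : bounded_mfun f -> bounded_mfun (fun w => `|f w|).
Proof.
move=> [mf [K fK]]; split; first exact: measurableT_comp.
by exists K => w; rewrite normr_id.
Qed.

Lemma bounded_mfun_sum (I : Type) (r : seq I) (F : I -> T -> R) :
  (forall i, bounded_mfun (F i)) -> bounded_mfun (fun w => \sum_(i <- r) F i w).
Proof.
move=> bF; elim: r => [|i r IH].
  by under eq_fun do rewrite big_nil; exact: bounded_mfun_cst.
by under eq_fun do rewrite big_cons; exact: bounded_mfunD.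
Qed.

Variable P : probability T R.

Definition Ex f : R := \int[P]_w f w.

Lemma bounded_mfun_integrable f : bounded_mfun f ->
  P.-integrable [set: T] (EFin \o f).
Proof.
move=> [mf [K fK]]; apply: measurable_bounded_integrable => //.
  exact: (le_lt_trans (probability_le1 P measurableT) (ltry 1)).
exists K; split; first exact: num_real.
by move=> x Kx w _; exact: le_trans (fK w) (ltW Kx).
Qed.

Lemma expectationE f : bounded_mfun f -> 'E_P[f]%E = (Ex f)%:E.
Proof.
move=> bf; rewrite unlock /Ex /Rintegral fineK//.
exact/integrable_fin_num/bounded_mfun_integrable.
Qed.

Lemma Ex_cst c : Ex (fun=> c) = c.
Proof. by rewrite /Ex Rintegral_cst//= probability_setT mulr1. Qed.

Lemma ExD f h : bounded_mfun f -> bounded_mfun h ->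
  Ex (fun w => f w + h w) = Ex f + Ex h.
Proof. by move=> bf bh; apply: RintegralD => //; exact: bounded_mfun_integrable. Qed.

Lemma ExB f h : bounded_mfun f -> bounded_mfun h ->
  Ex (fun w => f w - h w) = Ex f - Ex h.
Proof. by move=> bf bh; apply: RintegralB => //; exact: bounded_mfun_integrable. Qed.

Lemma ExZ c f : bounded_mfun f -> Ex (fun w => c * f w) = c * Ex f.
Proof. by move=> bf; apply: RintegralZl => //; exact: bounded_mfun_integrable. Qed.

Lemma Ex_sum (I : Type) (r : seq I) (F : I -> T -> R) :
  (forall i, bounded_mfun (F i)) ->
  Ex (fun w => \sum_(i <- r) F i w) = \sum_(i <- r) Ex (F i).
Proof.
move=> bF; elim: r => [|i r IH].
  by under eq_fun do rewrite big_nil; rewrite big_nil Ex_cst.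
under eq_fun do rewrite big_cons.
by rewrite big_cons ExD// ?IH//; exact: bounded_mfun_sum.
Qed.

Lemma Ex_le f h : bounded_mfun f -> bounded_mfun h ->
  (forall w, f w <= h w) -> Ex f <= Ex h.
Proof. by move=> bf bh fh; apply: le_Rintegral => //; exact: bounded_mfun_integrable. Qed.

Lemma Ex_ge0 f : (forall w, 0 <= f w) -> 0 <= Ex f.
Proof. by move=> f0; apply: Rintegral_ge0. Qed.

Lemma Ex_norm_le f K : bounded_mfun f -> (forall w, `|f w| <= K) -> `|Ex f| <= K.
Proof.
move=> bf fK; rewrite ler_norml; apply/andP; split.
  rewrite -[leLHS](Ex_cst (- K)); apply: Ex_le => //; first exact: bounded_mfun_cst.
  by move=> w; have := fK w; rewrite ler_norml => /andP[].
rewrite -[leRHS](Ex_cst K); apply: Ex_le => //; first exact: bounded_mfun_cst.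
by move=> w; have := fK w; rewrite ler_norml => /andP[].
Qed.

Lemma norm_Ex_le f : bounded_mfun f -> `|Ex f| <= Ex (fun w => `|f w|).
Proof. by move=> bf; apply: le_normr_Rintegral => //; exact: bounded_mfun_integrable. Qed.

Lemma Ex_variance f : bounded_mfun f ->
  Ex (fun w => (f w - Ex f) ^+ 2) = Ex (fun w => f w ^+ 2) - Ex f ^+ 2.
Proof.
move=> bf.
have bf2 := bounded_mfun_sqr bf.
have bZ := bounded_mfunZ (2 * Ex f) bf.
transitivity (Ex (fun w => (f w ^+ 2 - 2 * Ex f * f w) + Ex f ^+ 2)).
  by congr Ex; apply/funext => w; ring.
rewrite ExD; [|exact: bounded_mfunB|exact: bounded_mfun_cst].
by rewrite ExB// ExZ// Ex_cst; ring.
Qed.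

Lemma Ex_sqr_le f : bounded_mfun f -> Ex f ^+ 2 <= Ex (fun w => f w ^+ 2).
Proof.
by move=> bf; rewrite -subr_ge0 -Ex_variance//; apply: Ex_ge0 => w; exact: sqr_ge0.
Qed.

Lemma variance_le_Ex_sqr f : bounded_mfun f ->
  Ex (fun w => (f w - Ex f) ^+ 2) <= Ex (fun w => f w ^+ 2).
Proof. by move=> bf; rewrite Ex_variance// gerBl sqr_ge0. Qed.

(** Minkowski's inequality in L2, in a form that propagates upper bounds without
    square roots. *)
Lemma Ex_minkowski f h x y : bounded_mfun f -> bounded_mfun h ->
  0 <= x -> 0 <= y ->
  Ex (fun w => f w ^+ 2) <= x ^+ 2 -> Ex (fun w => h w ^+ 2) <= y ^+ 2 ->
  Ex (fun w => (f w + h w) ^+ 2) <= (x + y) ^+ 2.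
Proof.
move=> bf bh x0 y0 fx hy.
have bf2 := bounded_mfun_sqr bf; have bh2 := bounded_mfun_sqr bh.
have bfh := bounded_mfun_sqr (bounded_mfunD bf bh).
(* Young's inequality with the weight [v / u], which needs positive bounds; the
   bounds [x] and [y] are then approached from above *)
have pos u v : 0 < u -> 0 < v -> x <= u -> y <= v ->
    Ex (fun w => (f w + h w) ^+ 2) <= (u + v) ^+ 2.
  move=> u0 v0 xu yv.
  have fu : Ex (fun w => f w ^+ 2) <= u ^+ 2.
    by rewrite (le_trans fx)// ler_pXn2r// nnegrE ltW.
  have hv : Ex (fun w => h w ^+ 2) <= v ^+ 2.
    by rewrite (le_trans hy)// ler_pXn2r// nnegrE ltW.
  apply: (@le_trans _ _ (Ex (fun w => (1 + v / u) * f w ^+ 2 + (1 + u / v) * h w ^+ 2))).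
    apply: Ex_le => //; first by apply: bounded_mfunD; exact: bounded_mfunZ.
    move=> w; rewrite -subr_ge0.
    have -> : (1 + v / u) * f w ^+ 2 + (1 + u / v) * h w ^+ 2 - (f w + h w) ^+ 2 =
      (v * f w - u * h w) ^+ 2 / (u * v) by field; rewrite !gt_eqF.
    by rewrite divr_ge0 ?sqr_ge0// mulr_ge0// ltW.
  rewrite ExD ?ExZ//; try exact: bounded_mfunZ.
  have -> : (u + v) ^+ 2 = (1 + v / u) * u ^+ 2 + (1 + u / v) * v ^+ 2.
    by field; rewrite !gt_eqF.
  by rewrite lerD// ler_wpM2l// addr_ge0// divr_ge0// ltW.
have fh0 : 0 <= Ex (fun w => (f w + h w) ^+ 2) by apply: Ex_ge0 => w; exact: sqr_ge0.
rewrite -(sqr_sqrtr fh0) ler_pXn2r ?nnegrE ?sqrtr_ge0 ?addr_ge0//.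
apply/ler_addgt0Pr => e e0.
have e20 : 0 < e / 2 by rewrite divr_gt0.
have -> : x + y + e = (x + e / 2) + (y + e / 2) by field.
rewrite -(@ler_pXn2r _ 2) ?nnegrE ?sqrtr_ge0 ?addr_ge0 ?(ltW e20)// sqr_sqrtr//.
by apply: pos; rewrite ?lerDl ?(ltW e20)// ltr_wpDl.
Qed.

End BoundedExpectation.

Lemma bounded_mfun_maxval {R : realType} {A : pointedType} {d}
    {T : measurableType d} (F : A -> T -> R) K :
  finite_set [set: A] -> (forall b, measurable_fun [set: T] (F b)) ->
  (forall b w, `|F b w| <= K) -> bounded_mfun (fun w => maxval (F ^~ w)).
Proof.
move=> finA mF FK; split; first exact: measurable_maxval.
by exists K => w; exact: maxval_norm_le.
Qed.

Lemma bounded_mfun_comp {R : realType} d1 d2 (T1 : measurableType d1)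
    (T2 : measurableType d2) (phi : T1 -> T2) (f : T2 -> R) :
  measurable_fun [set: T1] phi -> bounded_mfun f ->
  bounded_mfun (fun w => f (phi w)).
Proof.
by move=> mphi [mf [K fK]]; split; [exact: measurableT_comp|exists K => w; exact: fK].
Qed.

Section Fubini.
Context {d1 d2} {T1 : measurableType d1} {T2 : measurableType d2} {R : realType}.
Variables (P1 : probability T1 R) (P2 : probability T2 R).
Variables (H : T1 * T2 -> R) (bH : bounded_mfun H).

Lemma bounded_mfun_section1 x : bounded_mfun (fun y => H (x, y)).
Proof. by apply: (@bounded_mfun_comp _ _ _ _ _ (pair x) H). Qed.

Lemma bounded_mfun_section2 y : bounded_mfun (fun x => H (x, y)).
Proof. by apply: (@bounded_mfun_comp _ _ _ _ _ (pair^~ y) H). Qed.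

Lemma bounded_mfun_Ex : bounded_mfun (fun x => Ex P2 (fun y => H (x, y))).
Proof.
split.
  apply/measurable_EFinP.
  rewrite (_ : _ \o _ = fubini_F P2 (EFin \o H)).
    (* any probability on the first factor makes [H] integrable *)
    exact: measurable_fubini_F
      (bounded_mfun_integrable ((dirac point : probability T1 R) \x P2)%E bH).
  apply/funext => x; rewrite /= /Ex /Rintegral fineK//.
  exact/integrable_fin_num/bounded_mfun_integrable/bounded_mfun_section1.
have [K HK] := bH.2; exists K => x.
by apply: Ex_norm_le => //; exact: bounded_mfun_section1.
Qed.

Let intH : (P1 \x P2)%E.-integrable [set: T1 * T2] (EFin \o H).
Proof. exact: (bounded_mfun_integrable (P1 \x P2)%E bH). Qed.

Lemma Ex_prod : Ex (P1 \x P2)%E H = Ex P1 (fun x => Ex P2 (fun y => H (x, y))).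
Proof.
rewrite {1 2}/Ex /Rintegral -integral12_prod_meas1//; congr fine.
apply: eq_integral => x _.
rewrite /fubini_F /Ex /Rintegral fineK//.
exact/integrable_fin_num/bounded_mfun_integrable/bounded_mfun_section1.
Qed.

Lemma Ex_prod_swap :
  Ex (P1 \x P2)%E H = Ex P2 (fun y => Ex P1 (fun x => H (x, y))).
Proof.
rewrite {1 2}/Ex /Rintegral -integral21_prod_meas1//; congr fine.
apply: eq_integral => x _.
rewrite /fubini_G /Ex /Rintegral fineK//.
exact/integrable_fin_num/bounded_mfun_integrable/bounded_mfun_section2.
Qed.

Lemma Ex_Fubini : Ex P1 (fun x => Ex P2 (fun y => H (x, y))) =
  Ex P2 (fun y => Ex P1 (fun x => H (x, y))).
Proof. by rewrite -Ex_prod Ex_prod_swap. Qed.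

End Fubini.

Section ImageLaw.
Context {d d'} {T : measurableType d} {T' : measurableType d'} {R : realType}.
Variables (P : probability T R) (phi : T -> T').
Hypothesis mphi : measurable_fun [set: T] phi.

Definition mfun_of : {mfun T >-> T'} :=
  MeasurableFun.Pack (MeasurableFun.Class (isMeasurableFun.Build _ _ _ _ _ mphi)).

Definition image_law : probability T' R := distribution P mfun_of.

Lemma Ex_image_law (f : T' -> R) : bounded_mfun f ->
  Ex image_law f = Ex P (f \o phi).
Proof.
move=> bf; rewrite /Ex /Rintegral; congr fine.
rewrite /image_law /distribution integral_pushforward//.
  exact/measurable_EFinP/bf.1.
exact/bounded_mfun_integrable/(bounded_mfun_comp mphi).
Qed.

End ImageLaw.

Lemma eq_Ex_law {d} {T : measurableType d} {R : realType} (P P' : probability T R)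
    (f : T -> R) :
  (forall B, measurable B -> P B = P' B) -> Ex P f = Ex P' f.
Proof.
move=> PP'; rewrite /Ex /Rintegral; congr fine.
by apply: eq_measure_integral => B mB _; exact: PP'.
Qed.

Section Decoupling.
Context {d d1 d2} {T : measurableType d} {T1 : measurableType d1}
  {T2 : measurableType d2} {R : realType}.
Variables (P : probability T R) (phi1 : T -> T1) (phi2 : T -> T2).
Hypotheses (mphi1 : measurable_fun [set: T] phi1)
  (mphi2 : measurable_fun [set: T] phi2).
Hypothesis indep : forall B1 B2, measurable B1 -> measurable B2 ->
  P ((phi1 @^-1` B1) `&` (phi2 @^-1` B2)) = (P (phi1 @^-1` B1) * P (phi2 @^-1` B2))%E.

(** The joint law of the two maps agrees with the product of their laws on rectangles,
    hence everywhere; Fubini's theorem then applies to the product. *)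
Lemma Ex_decoupling (H : T1 * T2 -> R) : bounded_mfun H ->
  Ex P (fun w => H (phi1 w, phi2 w)) =
  Ex P (fun w1 => Ex P (fun w2 => H (phi1 w1, phi2 w2))).
Proof.
move=> bH.
have mphi : measurable_fun [set: T] (fun w => (phi1 w, phi2 w)).
  exact: measurable_fun_pair.
transitivity (Ex (image_law P mphi) H); first by rewrite Ex_image_law.
transitivity (Ex (image_law P mphi1 \x image_law P mphi2)%E H).
  apply/esym/eq_Ex_law => B mB.
  by apply: product_measure_unique mB => B1 B2 mB1 mB2; exact: indep.
rewrite Ex_prod// Ex_image_law; last exact: bounded_mfun_Ex.
congr Ex; apply/funext => w /=.
by rewrite Ex_image_law//; exact: bounded_mfun_section1.
Qed.

End Decoupling.

(** * Independence of pooled sigma-algebras *)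

Section Grouping.
Context {d} {Omega : measurableType d} {R : realType} (P : probability Omega R).

(** Both sides, as functions of [A], are finite measures that agree on a pi-system. *)
Lemma pi_system_indep (C : set (set Omega)) (B : set Omega) :
  C `<=` measurable -> setI_closed C -> C setT -> measurable B ->
  (forall A, C A -> P (A `&` B) = (P A * P B)%E) ->
  forall A, <<s C >> A -> P (A `&` B) = (P A * P B)%E.
Proof.
move=> mC CI CT mB CB A sA.
have PB0 : (0 <= fine (P B))%R by exact: fine_ge0.
have PBE : (fine (P B))%:E = P B by rewrite fineK// fin_num_measure.
have : mrestr P mB A = mscale (NngNum PB0) P A.
  apply: (g_sigma_algebra_measure_unique C mC (fun=> setT)) sA => //.
  - by rewrite bigcup_const.
  - by move=> D CD; rewrite /= /mrestr /mscale /= CB// PBE muleC.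
  - move=> _; apply: le_lt_trans (ltry 1); rewrite /= /mrestr.
    by apply: probability_le1; exact: measurableI.
by rewrite /mrestr /mscale /= PBE muleC.
Qed.

Context {I : choiceType} (G : I -> set (set Omega)).
Hypotheses (Gsub : forall i, sub_sigma (G i)) (Gindep : independent P G).

(** Generators only; the pooled sigma-algebra is [<<s pooled S >>]. *)
Definition pooled (S : set I) : set (set Omega) := \bigcup_(i in S) G i.

Let GT i : G i setT.
Proof.
have [[G0 GD _] _] := Gsub i.
by rewrite -(setD0 setT); exact: GD.
Qed.

Let GI i A B : G i A -> G i B -> G i (A `&` B).
Proof.
move=> GA GB.
have sG := (Gsub i).1.
have [G0 GD GU] := sG.
have -> : A `&` B = setT `\` ((setT `\` A) `|` (setT `\` B)).
  by rewrite !setTD setCU !setCK.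
apply: (GD); rewrite -bigcup2E; apply: GU => -[|[|n]] //=; exact: GD.
Qed.

(** The pi-system to which the product rule of mutual independence applies directly. *)
Let finite_meets (S : set I) : set (set Omega) :=
  [set B | exists (s : seq I) (E : I -> set Omega),
    [/\ forall i, i \in s -> S i, forall i, G i (E i) &
        B = \bigcap_(i in [set` s]) E i]].

Let finite_meetsT S : finite_meets S setT.
Proof.
exists [::], (fun=> setT); split => //.
by apply/seteqP; split => // x _ i.
Qed.

Let finite_meetsI S : setI_closed (finite_meets S).
Proof.
move=> _ _ [s [E [sS GE ->]]] [t [F [tS GF ->]]].
exists (s ++ t), (fun i => (if i \in s then E i else setT) `&`
                           (if i \in t then F i else setT)); split.
- by move=> i; rewrite mem_cat => /orP[/sS|/tS].
- by move=> i; apply: GI; case: ifP.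
- apply/seteqP; split => w /=.
    move=> [Ew Fw] i /=; rewrite mem_cat => _.
    by split; case: ifP => // ii; [exact: Ew|exact: Fw].
  move=> EF; split => i /= ii; have := EF i; rewrite /= mem_cat ii.
    by move=> /(_ isT)[].
  by rewrite orbT => /(_ isT)[].
Qed.

Let finite_meets_measurable S : finite_meets S `<=` measurable.
Proof.
move=> _ [s [E [_ GE ->]]]; apply: fin_bigcap_measurable.
  exact: finite_seq.
by move=> i _; apply: (Gsub i).2.
Qed.

Let pooled_finite_meets S : pooled S `<=` finite_meets S.
Proof.
move=> B [i Si GB]; exists [:: i], (fun j => if j == i then B else setT); split.
- by move=> j; rewrite inE => /eqP->.
- by move=> j; case: eqP => [->|].
- apply/seteqP; split => w.
    by move=> Bw j /=; rewrite inE => ->.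
  by move=> /(_ i) /=; rewrite inE eqxx; exact.
Qed.

Let meets_prod (s : seq I) (E : I -> set Omega) : (forall i, G i (E i)) ->
  uniq s -> P (\bigcap_(i in [set` s]) E i) = (\prod_(i <- s) P (E i))%E.
Proof. by move=> GE us; exact: Gindep. Qed.

Let finite_meets_indep S S' B B' : S `&` S' = set0 ->
  finite_meets S B -> finite_meets S' B' -> P (B `&` B') = (P B * P B')%E.
Proof.
move=> SS' [s0 [E [sS GE ->]]] [t0 [F [tS GF ->]]].
wlog us : s0 sS / uniq s0.
  move=> /(_ (undup s0)); rewrite undup_uniq.
  rewrite (_ : [set` undup s0] = [set` s0]).
    by apply => // i; rewrite mem_undup; exact: sS.
  by apply/seteqP; split => i /=; rewrite mem_undup.
wlog ut : t0 tS / uniq t0.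
  move=> /(_ (undup t0)); rewrite undup_uniq.
  rewrite (_ : [set` undup t0] = [set` t0]).
    by apply => // i; rewrite mem_undup; exact: tS.
  by apply/seteqP; split => i /=; rewrite mem_undup.
have disj i : i \in s0 -> i \in t0 -> False.
  by move=> /sS Si /tS S'i; have : (S `&` S') i by []; rewrite SS'.
pose H i := if i \in s0 then E i else F i.
have GH i : G i (H i) by rewrite /H; case: ifP.
have sH i : i \in s0 -> H i = E i by rewrite /H => ->.
have tH i : i \in t0 -> H i = F i.
  by rewrite /H; case: ifPn => // si ti; case: (disj i).
have -> : \bigcap_(i in [set` s0]) E i `&` \bigcap_(i in [set` t0]) F i =
    \bigcap_(i in [set` s0 ++ t0]) H i.
  apply/seteqP; split => w /=.
    move=> [Ew Fw] i /=; rewrite mem_cat => /orP[ii|ii].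
      by rewrite sH//; exact: Ew.
    by rewrite tH//; exact: Fw.
  move=> Hw; split => i /= ii.
    by rewrite -sH//; apply: Hw; rewrite /= mem_cat ii.
  by rewrite -tH//; apply: Hw; rewrite /= mem_cat ii orbT.
rewrite !meets_prod//; last first.
  rewrite cat_uniq us ut andbT/=; apply/hasPn => i it; apply/negP => is_.
  exact: (disj i).
rewrite big_cat/=; congr (_ * _)%E.
  by rewrite big_seq [RHS]big_seq; apply: eq_bigr => i /sH ->.
by rewrite big_seq [RHS]big_seq; apply: eq_bigr => i /tH ->.
Qed.

Lemma pooled_measurable S : <<s pooled S >> `<=` measurable.
Proof.
apply: smallest_sub; first exact: sigma_algebra_measurable.
by move=> B [i _ GB]; apply: (Gsub i).2.
Qed.

(** Finite intersections of events of disjoint families factorise by definition; extend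
    to the generated sigma-algebras one side at a time. *)
Lemma pooled_indep S S' B B' : S `&` S' = set0 ->
  <<s pooled S >> B -> <<s pooled S' >> B' -> P (B `&` B') = (P B * P B')%E.
Proof.
move=> SS' sB sB'.
have meets Q C : <<s pooled Q >> C -> <<s finite_meets Q >> C.
  by apply: sub_sigma_algebra2; exact: pooled_finite_meets.
apply: (pi_system_indep (finite_meets_measurable (S:=S))) (meets _ _ sB) => //.
  exact: pooled_measurable sB'.
move=> A mA; rewrite setIC muleC.
apply: (pi_system_indep (finite_meets_measurable (S:=S'))) (meets _ _ sB') => //.
  exact: finite_meets_measurable mA.
by move=> A' mA'; rewrite setIC muleC; exact: finite_meets_indep SS' mA mA'.
Qed.

End Grouping.

(** * Laws of random fields *)

Section PathSpace.
Context {J : Type} {dE} {E : measurableType dE}.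

(** The generators of [product_sigma], named so that path space is a measurable type
    whose measurable sets are convertible to [product_sigma J E]. *)
Definition cylinders : set (set (J -> E)) :=
  \bigcup_(j in [set: J])
    preimage_set_system [set: J -> E] (fun f => f j) measurable.

Definition path_space := g_sigma_algebraType cylinders.

Lemma measurable_eval j : measurable_fun [set: path_space] (fun u : path_space => u j).
Proof.
move=> _ B mB; apply: sub_sigma_algebra.
by exists j => //; exists B.
Qed.

Lemma measurable_to_path d (T : measurableType d) (U : T -> path_space) :
  (forall j, measurable_fun [set: T] (fun w => U w j)) -> measurable_fun [set: T] U.
Proof.
move=> mU; apply: (@measurability _ _ T path_space setT U cylinders) => //.
move=> _ [_ [j _ [B mB <-]] <-].
rewrite !setTI; have := mU j measurableT B mB.
by rewrite setTI.
Qed.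

End PathSpace.
Arguments path_space J {dE} E.

Section Laws.
Context {d} {Omega : measurableType d} {R : realType} (P : probability Omega R).

(** Equality in law tested by bounded functionals of the whole path: this form composes
    with measurable maps of paths and can be used inside iterated expectations. *)
Definition same_law {J : Type} {dE} {E : measurableType dE} (U V : Omega -> J -> E) :=
  forall h : path_space J E -> R, bounded_mfun h ->
    Ex P (fun w => h (U w)) = Ex P (fun w => h (V w)).

Lemma same_law_of_events {J : Type} {dE} {E : measurableType dE}
    (U V : Omega -> J -> E) :
  (forall j, measurable_fun [set: Omega] (fun w => U w j)) ->
  (forall j, measurable_fun [set: Omega] (fun w => V w j)) ->
  (forall B, product_sigma J E B -> P (U @^-1` B) = P (V @^-1` B)) ->
  same_law U V.
Proof.
move=> mU mV UV h bh.
have mU' : measurable_fun [set: Omega] (U : Omega -> path_space J E).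
  exact: measurable_to_path.
have mV' : measurable_fun [set: Omega] (V : Omega -> path_space J E).
  exact: measurable_to_path.
rewrite -[LHS](Ex_image_law P mU' bh) -[RHS](Ex_image_law P mV' bh).
by apply: eq_Ex_law => B; exact: UV.
Qed.

Section Decouple.
Variables C1 C2 : set (set Omega).
Hypotheses (mC1 : <<s C1 >> `<=` measurable) (mC2 : <<s C2 >> `<=` measurable).
Hypothesis indepC : forall B1 B2, <<s C1 >> B1 -> <<s C2 >> B2 ->
  P (B1 `&` B2) = (P B1 * P B2)%E.

(** Reading one sample through two independent sigma-algebras is the same, in mean, as
    drawing two samples. *)
Lemma Ex_decouple (H : g_sigma_algebraType C1 * g_sigma_algebraType C2 -> R) :
  bounded_mfun H ->
  Ex P (fun w => H (w, w)) = Ex P (fun w1 => Ex P (fun w2 => H (w1, w2))).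
Proof.
move=> bH.
apply: (@Ex_decoupling _ _ _ _ _ _ _ P (fun w => w : g_sigma_algebraType C1)
  (fun w => w : g_sigma_algebraType C2)) => //.
- by move=> _ B mB; rewrite setTI; exact: mC1.
- by move=> _ B mB; rewrite setTI; exact: mC2.
Qed.

End Decouple.

Section Mixing.
Context {J1 J2 J : Type} {d1 d2 dE} {E1 : measurableType d1} {E2 : measurableType d2}
  {E : measurableType dE}.
Variables (C1 C2 C1' C2' : set (set Omega)).
Hypotheses (mC1 : <<s C1 >> `<=` measurable) (mC2 : <<s C2 >> `<=` measurable)
  (mC1' : <<s C1' >> `<=` measurable) (mC2' : <<s C2' >> `<=` measurable).
Hypotheses (indepC : forall B1 B2, <<s C1 >> B1 -> <<s C2 >> B2 ->
    P (B1 `&` B2) = (P B1 * P B2)%E)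
  (indepC' : forall B1 B2, <<s C1' >> B1 -> <<s C2' >> B2 ->
    P (B1 `&` B2) = (P B1 * P B2)%E).
Variables (U U' : Omega -> J1 -> E1) (V V' : Omega -> J2 -> E2).
Variable Phi : (J1 -> E1) -> (J2 -> E2) -> J -> E.

Let jointly (D1 D2 : set (set Omega)) (u : Omega -> J1 -> E1) (v : Omega -> J2 -> E2) :=
  forall j, measurable_fun [set: g_sigma_algebraType D1 * g_sigma_algebraType D2]
    (fun z => Phi (u z.1) (v z.2) j).

Hypotheses (mUV : jointly C1 C2 U V) (mUV' : jointly C1 C2' U V')
  (mU'V' : jointly C1' C2' U' V').
Hypothesis mPhi2 : forall w j,
  measurable_fun [set: path_space J2 E2] (fun v : path_space J2 E2 => Phi (U w) v j).
Hypothesis mPhi1 : forall w j,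
  measurable_fun [set: path_space J1 E1] (fun u : path_space J1 E1 => Phi u (V' w) j).

(** If U and V are independent, the law of Phi (U, V) depends only on the laws of U and
    V. [Phi] is not assumed to be jointly measurable on the product of the two path
    spaces, since evaluating a path at a random point is not: it is only measurable
    along the samples, and in each path when the other is a fixed sample. That is
    enough to replace V by V' with U frozen, and then U by U' with V' frozen. *)
Lemma same_law_mix : same_law U U' -> same_law V V' ->
  same_law (fun w => Phi (U w) (V w)) (fun w => Phi (U' w) (V' w)).
Proof.
move=> UU' VV' h bh.
have bUV D1 D2 u v : jointly D1 D2 u v ->
    bounded_mfun (fun z : g_sigma_algebraType D1 * g_sigma_algebraType D2 =>
      h (Phi (u z.1) (v z.2))).
  move=> mj; apply: (@bounded_mfun_comp R _ _
    (g_sigma_algebraType D1 * g_sigma_algebraType D2)%type (path_space J E)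
    (fun z => Phi (u z.1) (v z.2)) h) bh.
  exact: measurable_to_path.
have up D : <<s D >> `<=` measurable ->
    measurable_fun [set: Omega] (fun w : Omega => w : g_sigma_algebraType D).
  by move=> mD _ B mB; rewrite setTI; exact: mD.
rewrite (Ex_decouple mC1 mC2 indepC (bUV _ _ _ _ mUV)).
rewrite (Ex_decouple mC1' mC2' indepC' (bUV _ _ _ _ mU'V')).
transitivity (Ex P (fun w1 => Ex P (fun w2 => h (Phi (U w1) (V' w2))))).
  congr Ex; apply/funext => w1; apply: (VV' (fun v => h (Phi (U w1) v))).
  apply: (@bounded_mfun_comp R _ _ (path_space J2 E2) (path_space J E) (Phi (U w1)) h) bh.
  exact: measurable_to_path.
have bO D1 D2 u v : <<s D1 >> `<=` measurable -> <<s D2 >> `<=` measurable ->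
    jointly D1 D2 u v ->
    bounded_mfun (fun z : Omega * Omega => h (Phi (u z.1) (v z.2))).
  move=> mD1 mD2 mj; apply: (@bounded_mfun_comp R _ _ (Omega * Omega)%type
    (g_sigma_algebraType D1 * g_sigma_algebraType D2)%type (fun z => (z.1, z.2)))
    (bUV _ _ _ _ mj).
  apply: measurable_fun_pair.
    exact: (measurableT_comp (up D1 mD1)
      (measurable_fst : measurable_fun [set: Omega * Omega] _)).
  exact: (measurableT_comp (up D2 mD2)
    (measurable_snd : measurable_fun [set: Omega * Omega] _)).
rewrite (Ex_Fubini P P (bO _ _ _ _ mC1 mC2' mUV')).
rewrite (Ex_Fubini P P (bO _ _ _ _ mC1' mC2' mU'V')).
congr Ex; apply/funext => w2; apply: (UU' (fun u => h (Phi u (V' w2)))).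
apply: (@bounded_mfun_comp R _ _ (path_space J1 E1) (path_space J E)
  (fun u => Phi u (V' w2)) h) bh.
exact: measurable_to_path.
Qed.

End Mixing.
End Laws.

(** * Random fields driven by pooled sigma-algebras *)

Section Fields.
Context {d} {Omega : measurableType d} {R : realType} (P : probability Omega R).
Context {I : choiceType} (F : I -> set (set Omega)).
Hypotheses (Fsub : forall i, sub_sigma (F i)) (Findep : independent P F).

(** The sample space with only the information carried by the indices in [S]. *)
Definition pooled_type (S : set I) := g_sigma_algebraType (pooled F S).

Lemma measurable_pooled_id S :
  measurable_fun [set: Omega] (fun w : Omega => w : pooled_type S).
Proof. by move=> _ B mB; rewrite setTI; exact: (pooled_measurable Fsub mB). Qed.

Lemma bounded_mfun_pooled S (f : Omega -> R) :
  @bounded_mfun _ (pooled_type S) R f -> bounded_mfun f.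
Proof.
by apply: (@bounded_mfun_comp R _ _ Omega (pooled_type S) id f);
  exact: measurable_pooled_id.
Qed.

Lemma measurable_pooled_sub S S' : S `<=` S' ->
  measurable_fun [set: pooled_type S'] (fun w : pooled_type S' => w : pooled_type S).
Proof.
move=> SS' _ B mB; rewrite setTI; apply: sub_sigma_algebra2 mB => C [i Si FC].
by exists i => //; exact: SS'.
Qed.

Lemma Ex_pooled_decouple S1 S2 (H : pooled_type S1 * pooled_type S2 -> R) :
  S1 `&` S2 = set0 -> bounded_mfun H ->
  Ex P (fun w => H (w, w)) = Ex P (fun w1 => Ex P (fun w2 => H (w1, w2))).
Proof.
move=> S12; apply: Ex_decouple.
- exact: pooled_measurable.
- exact: pooled_measurable.
- by move=> B1 B2; exact: pooled_indep.
Qed.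

Lemma Ex_pooled_mul S1 S2 (f : pooled_type S1 -> R) (h : pooled_type S2 -> R) :
  S1 `&` S2 = set0 -> bounded_mfun f -> bounded_mfun h ->
  Ex P (fun w => f w * h w) = Ex P f * Ex P h.
Proof.
move=> S12 bf bh.
rewrite (@Ex_pooled_decouple S1 S2 (fun z => f z.1 * h z.2))//; last first.
  apply: bounded_mfunM.
    exact: (@bounded_mfun_comp R _ _ (pooled_type S1 * pooled_type S2)%type _ fst f).
  exact: (@bounded_mfun_comp R _ _ (pooled_type S1 * pooled_type S2)%type _ snd h).
rewrite [RHS]mulrC -ExZ; last exact: bounded_mfun_pooled bf.
congr Ex; apply/funext => w1 /=.
by rewrite ExZ 1?mulrC//; exact: bounded_mfun_pooled bh.
Qed.

Context {dY} {Y : measurableType dY} {A : pointedType}.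
Hypothesis finA : finite_set [set: A].

Local Notation point_type := (Y * discrete A)%type.

(** Joint measurability in the point and the sample, so that the field may be evaluated
    at a random point. *)
Definition field_mfun {dE} {E : measurableType dE} (S : set I)
    (W : point_type -> Omega -> E) :=
  measurable_fun [set: point_type * pooled_type S] (fun z => W z.1 z.2).

Definition argpair (y : Y) (b : A) : point_type := (y, b : discrete A).

Section FieldBasics.
Context {dE} {E : measurableType dE}.
Implicit Type W : point_type -> Omega -> E.

Lemma field_mfun_sub S S' W : S `<=` S' -> field_mfun S W -> field_mfun S' W.
Proof.
move=> SS' mW.
apply: (measurableT_comp mW (measurable_fun_pair
  (measurable_fst : measurable_fun [set: point_type * pooled_type S'] _) _)).
exact: (measurableT_comp (measurable_pooled_sub SS')
  (measurable_snd : measurable_fun [set: point_type * pooled_type S'] _)).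
Qed.

Lemma field_mfun_comp S W d' (T : measurableType d') (p : T -> point_type)
    (o : T -> pooled_type S) :
  field_mfun S W -> measurable_fun [set: T] p -> measurable_fun [set: T] o ->
  measurable_fun [set: T] (fun t => W (p t) (o t)).
Proof.
by move=> mW mp mo; exact: (measurableT_comp mW (measurable_fun_pair mp mo)).
Qed.

Lemma field_mfun_pooled S W p : field_mfun S W ->
  measurable_fun [set: pooled_type S] (W p).
Proof. by move=> mW; exact: (@field_mfun_comp S W _ (pooled_type S) (fun=> p) id mW). Qed.

Lemma field_mfun_sample S W p : field_mfun S W -> measurable_fun [set: Omega] (W p).
Proof.
move=> mW; apply: (@field_mfun_comp S W _ Omega (fun=> p) id mW) => //.
exact: measurable_pooled_id.
Qed.

Lemma field_mfun_point S W w : field_mfun S W ->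
  measurable_fun [set: point_type] (W^~ w).
Proof. by move=> mW; exact: (@field_mfun_comp S W _ point_type id (fun=> w) mW). Qed.

Lemma field_mfun_joint S W : field_mfun S W ->
  measurable_fun [set: point_type * Omega] (fun z => W z.1 z.2).
Proof.
move=> mW; apply: (@field_mfun_comp S W _ (point_type * Omega)%type fst snd mW) => //.
exact: (measurableT_comp (@measurable_pooled_id S)
  (measurable_snd : measurable_fun [set: point_type * Omega] _)).
Qed.

End FieldBasics.

Lemma measurable_argpair d' (T : measurableType d') (y : T -> Y) b :
  measurable_fun [set: T] y -> measurable_fun [set: T] (fun t => argpair (y t) b).
Proof. by move=> my; exact: measurable_fun_pair. Qed.

Definition greedy (W : point_type -> Omega -> R) (y : Y) (w : Omega) : R :=
  maxval (fun b : A => W (argpair y b) w).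

Lemma measurable_greedy S W d' (T : measurableType d') (y : T -> Y)
    (o : T -> pooled_type S) :
  field_mfun S W -> measurable_fun [set: T] y -> measurable_fun [set: T] o ->
  measurable_fun [set: T] (fun t => greedy W (y t) (o t)).
Proof.
move=> mW my mo; apply: (measurable_maxval finA) => b.
by apply: field_mfun_comp mW _ mo; exact: measurable_argpair.
Qed.

(** The shape of a summand of the scheme: both approximations are taken at the same next
    state, which is what makes their difference small. *)
Definition increment (xi : point_type -> Omega -> Y) (W W' : point_type -> Omega -> R)
    (p : point_type) (w : Omega) : R :=
  greedy W (xi p w) w - greedy W' (xi p w) w.

Lemma field_mfun_increment S xi W W' :
  field_mfun S xi -> field_mfun S W -> field_mfun S W' ->
  field_mfun S (increment xi W W').
Proof.
by move=> mxi mW mW'; apply: measurable_funB; apply: measurable_greedy.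
Qed.

(** Fields are written with the point first, for joint measurability; laws need the
    path of a given sample. *)
Definition sample {dE} {E : measurableType dE} (W : point_type -> Omega -> E)
  (w : Omega) (p : point_type) : E := W p w.

Lemma same_law_add S1 S2 S1' S2' (W V W' V' : point_type -> Omega -> R) :
  S1 `&` S2 = set0 -> S1' `&` S2' = set0 ->
  field_mfun S1 W -> field_mfun S2 V -> field_mfun S1' W' -> field_mfun S2' V' ->
  same_law P (sample W) (sample W') -> same_law P (sample V) (sample V') ->
  same_law P (sample (fun p w => W p w + V p w))
             (sample (fun p w => W' p w + V' p w)).
Proof.
move=> S12 S12' mW mV mW' mV' WW' VV'.
have mj Q1 Q2 (U1 U2 : point_type -> Omega -> R) :
    field_mfun Q1 U1 -> field_mfun Q2 U2 -> forall p,
    measurable_fun [set: pooled_type Q1 * pooled_type Q2]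
      (fun z => U1 p z.1 + U2 p z.2).
  move=> m1 m2 p; apply: measurable_funD.
    exact: (measurableT_comp (field_mfun_pooled p m1)
      (measurable_fst : measurable_fun [set: pooled_type Q1 * pooled_type Q2] _)).
  exact: (measurableT_comp (field_mfun_pooled p m2)
      (measurable_snd : measurable_fun [set: pooled_type Q1 * pooled_type Q2] _)).
apply: (@same_law_mix _ _ _ P _ _ _ _ _ _ _ _ _
  (pooled F S1) (pooled F S2) (pooled F S1') (pooled F S2') _ _ _ _ _ _
  (sample W) (sample W') (sample V) (sample V') (fun u v p => u p + v p)) => //.
all: try exact: pooled_measurable.
- by move=> B1 B2; exact: pooled_indep.
- by move=> B1 B2; exact: pooled_indep.
- exact: mj.
- exact: mj.
- exact: mj.
- move=> w p; apply: measurable_funD => //; exact: measurable_eval.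
- move=> w p; apply: measurable_funD => //; exact: measurable_eval.
Qed.

(** One field carrying the pair (W, W'), so that the joint law of the two fields is the
    law of a single path, as needed when both are evaluated at the same random state. *)
Let joined (W W' : point_type -> Omega -> R) (w : Omega) (cp : bool * point_type) : R :=
  if cp.1 then W cp.2 w else W' cp.2 w.

Let same_law_joined S2 S3 S2' S3' (W V W' V' : point_type -> Omega -> R) :
  S2 `&` S3 = set0 -> S2' `&` S3' = set0 ->
  field_mfun S2 W -> field_mfun S3 V -> field_mfun S2' W' -> field_mfun S3' V' ->
  same_law P (sample W) (sample W') -> same_law P (sample V) (sample V') ->
  same_law P (joined W V) (joined W' V').
Proof.
move=> S12 S12' mW mV mW' mV' WW' VV'.
have mj Q1 Q2 (U1 U2 : point_type -> Omega -> R) :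
    field_mfun Q1 U1 -> field_mfun Q2 U2 -> forall cp : bool * point_type,
    measurable_fun [set: pooled_type Q1 * pooled_type Q2]
      (fun z => (if cp.1 then U1 cp.2 z.1 else U2 cp.2 z.2)).
  move=> m1 m2 [[] p] /=.
    exact: (measurableT_comp (field_mfun_pooled p m1)
      (measurable_fst : measurable_fun [set: pooled_type Q1 * pooled_type Q2] _)).
  exact: (measurableT_comp (field_mfun_pooled p m2)
      (measurable_snd : measurable_fun [set: pooled_type Q1 * pooled_type Q2] _)).
apply: (@same_law_mix _ _ _ P _ _ _ _ _ _ _ _ _
  (pooled F S2) (pooled F S3) (pooled F S2') (pooled F S3') _ _ _ _ _ _
  (sample W) (sample W') (sample V) (sample V')
  (fun u v cp => if cp.1 then u cp.2 else v cp.2)) => //.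
all: try exact: pooled_measurable.
- by move=> B1 B2; exact: pooled_indep.
- by move=> B1 B2; exact: pooled_indep.
- exact: mj.
- exact: mj.
- exact: mj.
- by move=> w [[] p] //=; exact: measurable_eval.
- by move=> w [[] p] //=; exact: measurable_eval.
Qed.

(** The law of an increment is fixed by those of its three independent ingredients. First
    [W] and [V] are merged into one path, then the random state is mixed in. *)
Lemma same_law_increment S1 S2 S3 S1' S2' S3'
    (xi xi' : point_type -> Omega -> Y) (W V W' V' : point_type -> Omega -> R) :
  S1 `&` S2 = set0 -> S1 `&` S3 = set0 -> S2 `&` S3 = set0 ->
  S1' `&` S2' = set0 -> S1' `&` S3' = set0 -> S2' `&` S3' = set0 ->
  field_mfun S1 xi -> field_mfun S2 W -> field_mfun S3 V ->
  field_mfun S1' xi' -> field_mfun S2' W' -> field_mfun S3' V' ->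
  same_law P (sample xi) (sample xi') ->
  same_law P (sample W) (sample W') -> same_law P (sample V) (sample V') ->
  same_law P (sample (increment xi W V)) (sample (increment xi' W' V')).
Proof.
move=> S12 S13 S23 S12' S13' S23' mxi mW mV mxi' mW' mV' xx' WW' VV'.
have WV := same_law_joined S23 S23' mW mV mW' mV' WW' VV'.
pose Phi (u : point_type -> Y) (v : bool * point_type -> R) (p : point_type) : R :=
  maxval (fun b : A => v (true, argpair (u p) b)) -
  maxval (fun b : A => v (false, argpair (u p) b)).
have mj Q1 Q2 Q3 x (U1 U2 : point_type -> Omega -> R) :
    field_mfun Q1 x -> field_mfun Q2 U1 -> field_mfun Q3 U2 -> forall p,
    measurable_fun [set: pooled_type Q1 * pooled_type (Q2 `|` Q3)]
      (fun z => Phi (sample x z.1) (joined U1 U2 z.2) p).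
  move=> mx m1 m2 p.
  have mx1 : measurable_fun [set: pooled_type Q1 * pooled_type (Q2 `|` Q3)]
      (fun z => x p z.1).
    exact: (measurableT_comp (field_mfun_pooled p mx)
      (measurable_fst : measurable_fun [set: pooled_type Q1 * pooled_type (Q2 `|` Q3)] _)).
  have m2' : measurable_fun [set: pooled_type Q1 * pooled_type (Q2 `|` Q3)] snd.
    exact: measurable_snd.
  apply: measurable_funB; apply: (measurable_greedy (S := Q2 `|` Q3)) mx1 m2'.
    by apply: field_mfun_sub m1; exact: subsetUl.
  by apply: field_mfun_sub m2; exact: subsetUr.
have disjU Q1 Q2 Q3 : Q1 `&` Q2 = set0 -> Q1 `&` Q3 = set0 ->
    Q1 `&` (Q2 `|` Q3) = set0 :> set I.
  by move=> h2 h3; rewrite setIUr h2 h3 setU0.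
apply: (@same_law_mix _ _ _ P _ _ _ _ _ _ _ _ _
  (pooled F S1) (pooled F (S2 `|` S3)) (pooled F S1') (pooled F (S2' `|` S3'))
  _ _ _ _ _ _ (sample xi) (sample xi') (joined W V) (joined W' V') Phi) => //.
all: try exact: pooled_measurable.
- by move=> B1 B2; apply: pooled_indep => //; exact: disjU.
- by move=> B1 B2; apply: pooled_indep => //; exact: disjU.
- exact: mj.
- exact: mj.
- exact: mj.
- move=> w p; apply: measurable_funB; apply: (measurable_maxval finA) => b;
    exact: measurable_eval.
- move=> w p; apply: measurable_funB; apply: (measurable_maxval finA) => b /=.
    apply: (measurableT_comp (field_mfun_point w mW')).
    by apply: measurable_argpair; exact: measurable_eval.
  apply: (measurableT_comp (field_mfun_point w mV')).
  by apply: measurable_argpair; exact: measurable_eval.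
Qed.

(** Freezing an independent random state inside an expectation. *)
Lemma Ex_state_decouple S1 S2 (xi : point_type -> Omega -> Y) p
    (H : Y * pooled_type S2 -> R) :
  S1 `&` S2 = set0 -> field_mfun S1 xi -> bounded_mfun H ->
  Ex P (fun w => H (xi p w, w)) = Ex P (fun w1 => Ex P (fun w2 => H (xi p w1, w2))).
Proof.
move=> S12 mxi bH.
rewrite (@Ex_pooled_decouple S1 S2 (fun z => H (xi p z.1, z.2)))//.
apply: (@bounded_mfun_comp R _ _ (pooled_type S1 * pooled_type S2)%type
  (Y * pooled_type S2)%type (fun z => (xi p z.1, z.2)) H) => //.
apply: measurable_fun_pair => //.
exact: (measurableT_comp (field_mfun_pooled p mxi)
  (measurable_fst : measurable_fun [set: pooled_type S1 * pooled_type S2] _)).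
Qed.

Lemma same_law_image {J1 J2 : Type} {d1 d2} {E1 : measurableType d1}
    {E2 : measurableType d2} (Phi : (J1 -> E1) -> (J2 -> E2)) (U V : Omega -> J1 -> E1) :
  (forall j, measurable_fun [set: path_space J1 E1]
    (fun u : path_space J1 E1 => Phi u j)) ->
  same_law P U V -> same_law P (fun w => Phi (U w)) (fun w => Phi (V w)).
Proof.
move=> mPhi UV h bh; apply: (UV (fun u => h (Phi u))).
apply: (@bounded_mfun_comp R _ _ (path_space J1 E1) (path_space J2 E2) Phi h) bh.
exact: measurable_to_path.
Qed.

Section IndependentSums.
Context {K : eqType}.
Implicit Types (r : seq K) (B : K -> set I) (D : K -> point_type -> Omega -> R).

Definition supports B r : set I := [set i | exists2 k, k \in r & B k i].

Definition disjoint_supports B := forall k k', k != k' -> B k `&` B k' = set0.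

Lemma supports_head B k r : disjoint_supports B -> k \notin r ->
  B k `&` supports B r = set0.
Proof.
move=> dB kr; apply/seteqP; split => // i [ki [k' k'r k'i]].
by rewrite -(dB k k')//; apply: contraNneq kr => ->.
Qed.

Lemma supports_sub B k r : k \in r -> B k `<=` supports B r.
Proof. by move=> kr i ki; exists k. Qed.

Lemma field_mfun_sum B D r : (forall k, k \in r -> field_mfun (B k) (D k)) ->
  field_mfun (supports B r) (fun p w => \sum_(k <- r) D k p w).
Proof.
elim: r => [|k r IH] mD; rewrite /field_mfun.
  by under eq_fun do rewrite big_nil; exact: measurable_cst.
under eq_fun do rewrite big_cons; apply: measurable_funD.
  apply: field_mfun_sub (mD k (mem_head _ _)).
  by apply: supports_sub; exact: mem_head.
apply: (@field_mfun_sub _ _ (supports B r) _ (fun p w => \sum_(k' <- r) D k' p w)).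
  by move=> i [k' k'r k'i]; exists k' => //; rewrite inE k'r orbT.
by apply: IH => k' k'r; apply: mD; rewrite inE k'r orbT.
Qed.

(** Adding the summands one at a time: the head is independent of the sum of the tail,
    whose indices lie in the union of the other supports. *)
Lemma same_law_sum B B' D D' r : uniq r ->
  disjoint_supports B -> disjoint_supports B' ->
  (forall k, k \in r -> field_mfun (B k) (D k)) ->
  (forall k, k \in r -> field_mfun (B' k) (D' k)) ->
  (forall k, k \in r -> same_law P (sample (D k)) (sample (D' k))) ->
  same_law P (sample (fun p w => \sum_(k <- r) D k p w))
             (sample (fun p w => \sum_(k <- r) D' k p w)).
Proof.
move=> + dB dB'; elim: r => [|k r IH] /=.
  move=> _ _ _ _ h bh; congr Ex; apply/funext => w; congr h.
  by apply/funext => p; rewrite /sample !big_nil.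
move=> /andP[kr ur] mD mD' DD'.
have mem_r k' : k' \in r -> k' \in k :: r by rewrite inE => ->; rewrite orbT.
rewrite (_ : (fun p w => _) = (fun p w => D k p w + \sum_(k' <- r) D k' p w)); last first.
  by apply/funext => p; apply/funext => w; rewrite big_cons.
rewrite (_ : (fun p w => \sum_(_ <- k :: r) D' _ p w) =
    (fun p w => D' k p w + \sum_(k' <- r) D' k' p w)); last first.
  by apply/funext => p; apply/funext => w; rewrite big_cons.
apply: (@same_law_add (B k) (supports B r) (B' k) (supports B' r) (D k)
  (fun p w => \sum_(k' <- r) D k' p w) (D' k)
  (fun p w => \sum_(k' <- r) D' k' p w)).
- exact: supports_head.
- exact: supports_head.
- by apply: mD; exact: mem_head.
- by apply: field_mfun_sum => k' /mem_r; exact: mD.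
- by apply: mD'; exact: mem_head.
- by apply: field_mfun_sum => k' /mem_r; exact: mD'.
- by apply: DD'; exact: mem_head.
- by apply: IH => // k' /mem_r; [exact: mD|exact: mD'|exact: DD'].
Qed.

Lemma bounded_mfun_supports_sum B (Z : K -> Omega -> R) r :
  (forall k, @bounded_mfun _ (pooled_type (B k)) R (Z k)) ->
  @bounded_mfun _ (pooled_type (supports B r)) R (fun w => \sum_(k <- r) Z k w).
Proof.
move=> bZ.
have up S S' (f : Omega -> R) : S `<=` S' -> @bounded_mfun _ (pooled_type S) R f ->
    @bounded_mfun _ (pooled_type S') R f.
  move=> SS' bf.
  apply: (@bounded_mfun_comp R _ _ (pooled_type S') (pooled_type S) id f) bf.
  exact: measurable_pooled_sub.
elim: r => [|k r IH].
  by under eq_fun do rewrite big_nil; exact: bounded_mfun_cst.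
under eq_fun do rewrite big_cons; apply: bounded_mfunD.
  by apply: (up _ _ _ _ (bZ k)); apply: supports_sub; exact: mem_head.
by apply: (up _ _ _ _ IH) => i [k' k'r k'i]; exists k' => //; rewrite inE k'r orbT.
Qed.

(** Bienayme's identity: centred independent summands are orthogonal. *)
Lemma Ex_sqr_sum B (Z : K -> Omega -> R) r : uniq r -> disjoint_supports B ->
  (forall k, @bounded_mfun _ (pooled_type (B k)) R (Z k)) ->
  (forall k, Ex P (Z k) = 0) ->
  Ex P (fun w => (\sum_(k <- r) Z k w) ^+ 2) = \sum_(k <- r) Ex P (fun w => Z k w ^+ 2).
Proof.
move=> + dB bZ Z0.
have bZO k : bounded_mfun (Z k) by exact: bounded_mfun_pooled (bZ k).
elim: r => [|k r IH] /=.
  move=> _; rewrite big_nil; under eq_fun do rewrite big_nil expr0n.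
  exact: Ex_cst.
move=> /andP[kr ur].
have bS := bounded_mfun_supports_sum r bZ.
have bSO := bounded_mfun_pooled bS.
rewrite big_cons -IH//.
transitivity (Ex P (fun w => (Z k w ^+ 2 + 2 * (Z k w * \sum_(k' <- r) Z k' w)) +
                             (\sum_(k' <- r) Z k' w) ^+ 2)).
  by congr Ex; apply/funext => w; rewrite big_cons; ring.
have bZ2 := bounded_mfun_sqr (bZO k); have bS2 := bounded_mfun_sqr bSO.
have bZS := bounded_mfunM (bZO k) bSO.
rewrite !ExD ?ExZ//;
  try by [exact: bounded_mfunZ|apply: bounded_mfunD; [|exact: bounded_mfunZ]].
rewrite (Ex_pooled_mul (supports_head dB kr) (bZ k) bS) Z0.
by rewrite mul0r mulr0 addr0.
Qed.

End IndependentSums.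
End Fields.

(** * The tree of indices *)

Section IndexTree.
Implicit Types (theta eta : Theta) (k : nat * nat).

(** The indices of the fresh variables of the [k]-th summand, [k] standing for the level
    and the number of the copy. *)
Definition node theta k : Theta := Theta_cat theta k.1%:Z k.2%:Z.

(** The index under which the lagged approximation of the [k]-th summand is drawn. *)
Definition conode theta k : Theta := Theta_cat theta (- k.1%:Z) k.2%:Z.

(** The indices of all the variables that enter the scheme of index [theta]. *)
Definition below theta : set Theta :=
  [set eta | exists2 u : seq int, u != [::] & val eta = val theta ++ u].

(** The indices of all the variables that enter the [k]-th summand. The level is taken in
    absolute value so as to cover the node and the conode together. *)
Definition branch theta k : set Theta :=
  [set eta | exists (l : int) (u : seq int),
     `|l|%N = k.1 /\ val eta = val theta ++ [:: l, k.2%:Z & u]].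

Lemma branch_below theta k : branch theta k `<=` below theta.
Proof. by move=> eta [l [u [_ etaE]]]; exists [:: l, k.2%:Z & u]. Qed.

Lemma disjoint_branches theta : disjoint_supports (branch theta).
Proof.
move=> [l i] [l' i'] kk'; apply/seteqP; split => // eta.
move=> [[m [u [/= ml etaE]]] [m' [u' [/= ml' /eqP]]]].
rewrite etaE eqseq_cat// eqxx /= => /eqP[mm' ii' _].
by move/eqP: kk'; apply; rewrite -ml -ml' mm' ii'.
Qed.

Lemma node_branch theta k : branch theta k (node theta k).
Proof. by exists k.1%:Z, [::]; rewrite absz_nat. Qed.

Lemma below_node_branch theta k : below (node theta k) `<=` branch theta k.
Proof.
by move=> eta [u _ etaE]; exists k.1%:Z, u; rewrite absz_nat etaE /= -catA.
Qed.

Lemma below_conode_branch theta k : below (conode theta k) `<=` branch theta k.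
Proof.
by move=> eta [u _ etaE]; exists (- k.1%:Z), u; rewrite abszN absz_nat etaE /= -catA.
Qed.

Lemma node_notin_below theta k : [set node theta k] `&` below (node theta k) = set0.
Proof.
apply/seteqP; split => // _ [-> [u u0 /(congr1 size)/eqP]].
by rewrite size_cat -[X in X == _]addn0 eqn_add2l eq_sym size_eq0 (negPf u0).
Qed.

Lemma node_notin_below_conode theta k :
  [set node theta k] `&` below (conode theta k) = set0.
Proof.
apply/seteqP; split => // _ [-> [u u0 /(congr1 size)/eqP]].
rewrite /= !size_cat /= -[X in X == _]addn0 eqn_add2l eq_sym size_eq0.
by rewrite (negPf u0).
Qed.

Lemma below_node_conode theta k : (0 < k.1)%N ->
  below (node theta k) `&` below (conode theta k) = set0.
Proof.
move=> k0; apply/seteqP; split => // eta [[u _ etaE] [v _ /eqP]].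
rewrite etaE /= -!catA eqseq_cat// eqxx /= => /eqP[+ _].
by case: k.1 k0.
Qed.

End IndexTree.

(** * The Bellman equation *)

Lemma geometric_le_lim {R : realType} (x c K q : R) : 0 <= q < 1 ->
  (forall n, x <= c + K * q ^+ n) -> x <= c.
Proof.
move=> /andP[q0 q1] xc; apply/ler_addgt0Pr => e e0.
have : geometric K q @ \oo --> 0 by apply: cvg_geometric; rewrite ger0_norm.
move=> /cvgrPdist_lt /(_ e e0) [n _ /(_ n (leqnn n))] /=.
rewrite sub0r normrN => /(le_lt_trans (ler_norm _)) /ltW Kq.
by rewrite (le_trans (xc n))// lerD2l.
Qed.

(** The distance to the limit keeps the geometric rate, which makes the convergence of
    the Picard iterates uniform. *)
Lemma geometric_cauchy_cvg {R : realType} (u : R^nat) (K q : R) : 0 <= q < 1 ->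
  (forall n k, `|u (n + k)%N - u n| <= K * q ^+ n) ->
  exists l, u @ \oo --> l /\ forall n, `|l - u n| <= K * q ^+ n.
Proof.
move=> /andP[q0 q1] uK.
have K0 : 0 <= K by have := uK 0%N 0%N; rewrite expr0 mulr1; apply: le_trans.
have cu : cvgn u.
  have -> : u = (fun n => u 0%N + series (telescope u) n).
    by apply/funext => n; rewrite -eq_sum_telescope.
  apply: is_cvgD; first exact: is_cvg_cst.
  apply: normed_cvg; apply: (@series_le_cvg _ _ (geometric K q)).
  - by move=> n; exact: normr_ge0.
  - by move=> n; rewrite /= mulr_ge0// exprn_ge0.
  - by move=> n; rewrite /= /telescope /= -addn1; exact: uK.
  - by apply: is_cvg_geometric_series; rewrite ger0_norm.
exists (limn u); split => // n.
rewrite ler_distl; apply/andP; split.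
  apply: limr_ge => //; exists n => // m /= nm.
  by have := uK n (m - n)%N; rewrite subnKC// ler_distl => /andP[].
apply: limr_le => //; exists n => // m /= nm.
by have := uK n (m - n)%N; rewrite subnKC// ler_distl => /andP[].
Qed.

Section Bellman.
Context {d} {Omega : measurableType d} {R : realType} (P : probability Omega R).
Context {dY} {Y : measurableType dY} {A : pointedType}.
Hypothesis finA : finite_set [set: A].

Local Notation point_type := (Y * discrete A)%type.

Definition best (Q : point_type -> R) (y : Y) : R := maxval (fun b : A => Q (argpair y b)).

Lemma best_bmfun Q : bounded_mfun Q -> bounded_mfun (best Q).
Proof.
move=> [mQ [K QK]]; apply: (bounded_mfun_maxval (K := K)) => // b.
by apply: (measurableT_comp mQ); exact: measurable_argpair.
Qed.

Variable xi : point_type -> Omega -> Y.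
Hypothesis mxi : measurable_fun [set: point_type * Omega] (fun z => xi z.1 z.2).
Variables (g : point_type -> R) (G delta : R).
Hypotheses (mg : measurable_fun [set: point_type] g) (gG : forall p, `|g p| <= G).
Hypothesis delta01 : 0 <= delta < 1.

Definition bellman_op (Q : point_type -> R) (p : point_type) : R :=
  g p + delta * Ex P (fun w => best Q (xi p w)).

Let bH Q : bounded_mfun Q -> bounded_mfun (fun z : point_type * Omega => best Q (xi z.1 z.2)).
Proof.
by move=> bQ; exact: (@bounded_mfun_comp R _ _ (point_type * Omega)%type Y
  (fun z => xi z.1 z.2) (best Q) mxi (best_bmfun bQ)).
Qed.

Lemma next_best_bmfun Q p : bounded_mfun Q -> bounded_mfun (fun w => best Q (xi p w)).
Proof. by move=> bQ; exact: (bounded_mfun_section1 (bH bQ) p). Qed.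

Lemma bellman_op_bmfun Q : bounded_mfun Q -> bounded_mfun (bellman_op Q).
Proof.
move=> bQ; apply: bounded_mfunD; first by split => //; exists G.
exact/bounded_mfunZ/(bounded_mfun_Ex P (bH bQ)).
Qed.

Lemma bellman_op_contract Q Q' K : bounded_mfun Q -> bounded_mfun Q' ->
  (forall p, `|Q p - Q' p| <= K) ->
  forall p, `|bellman_op Q p - bellman_op Q' p| <= delta * K.
Proof.
move=> bQ bQ' QQ' p; have /andP[delta0 _] := delta01.
rewrite /bellman_op opprD addrACA subrr add0r -mulrBr normrM ger0_norm// ler_wpM2l//.
have bE := next_best_bmfun p bQ; have bE' := next_best_bmfun p bQ'.
rewrite -ExB//; apply: Ex_norm_le; first exact: bounded_mfunB.
by move=> w; rewrite (le_trans (maxval_dist finA _ _))//; exact: maxval_le.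
Qed.

Lemma bellman_op_contract_iter Q Q' K n : bounded_mfun Q -> bounded_mfun Q' ->
  (forall p, `|Q p - Q' p| <= K) ->
  forall p, `|iter n bellman_op Q p - iter n bellman_op Q' p| <= K * delta ^+ n.
Proof.
move=> bQ bQ' QQ'.
have bi m U : bounded_mfun U -> bounded_mfun (iter m bellman_op U).
  by move=> bU; elim: m => //= m; exact: bellman_op_bmfun.
elim: n => [p|n IH p /=]; first by rewrite expr0 mulr1.
by rewrite exprS mulrCA; apply: bellman_op_contract => //; exact: bi.
Qed.

Lemma bellman_unique Q Q' : bounded_mfun Q -> bounded_mfun Q' ->
  (forall p, Q p = bellman_op Q p) -> (forall p, Q' p = bellman_op Q' p) -> Q = Q'.
Proof.
move=> bQ bQ' fQ fQ'.
have fix_iter U : (forall p, U p = bellman_op U p) -> forall n, iter n bellman_op U = U.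
  by move=> fU; elim=> //= n ->; apply/funext => p; rewrite -fU.
have [K QK] := bQ.2; have [K' QK'] := bQ'.2.
apply/funext => p; apply/eqP; rewrite -subr_eq0 -normr_le0.
apply: (geometric_le_lim (K := K + K') delta01) => n; rewrite add0r.
rewrite -[Q in X in X <= _](fix_iter Q fQ n) -[Q' in X in X <= _](fix_iter Q' fQ' n).
by apply: bellman_op_contract_iter => // p'; rewrite (le_trans (ler_normB _ _))// lerD.
Qed.

Let G0 : 0 <= G. Proof. exact: le_trans (gG point). Qed.

Lemma bellman_op_bound Q K : bounded_mfun Q -> (forall p, `|Q p| <= K) ->
  forall p, `|bellman_op Q p| <= G + delta * K.
Proof.
move=> bQ QK p; have /andP[delta0 _] := delta01.
rewrite (le_trans (ler_normD _ _))// lerD// normrM ger0_norm// ler_wpM2l//.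
by apply: Ex_norm_le; [exact: next_best_bmfun|move=> w; exact: maxval_norm_le].
Qed.

(** Iterating |Q| <= K => |Q| <= G + delta K from an arbitrary bound K. *)
Lemma bellman_bound Q : bounded_mfun Q -> (forall p, Q p = bellman_op Q p) ->
  forall p, `|Q p| <= G / (1 - delta).
Proof.
move=> bQ fQ p; have /andP[delta0 delta1] := delta01.
have [K QK] := bQ.2.
apply: (geometric_le_lim (K := K) delta01) => n.
elim: n p => [|n IH] p.
  rewrite expr0 mulr1 (le_trans (QK p))// lerDr divr_ge0// subr_ge0 ltW//.
rewrite fQ (le_trans (bellman_op_bound bQ IH p))//.
rewrite le_eqVlt; apply/orP; left; apply/eqP; rewrite exprS.
by field; rewrite subr_eq0 gt_eqF.
Qed.

(** The limit of the Picard iterates from 0. They stay bounded by the fixed point of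
    K = G + delta K, so that by contraction the n-th one is within K delta^n of all later
    ones. *)
Lemma bellman_exists : exists2 Q, bounded_mfun Q & forall p, Q p = bellman_op Q p.
Proof.
have /andP[delta0 delta1] := delta01.
pose K := G / (1 - delta).
have K0 : 0 <= K by rewrite divr_ge0// subr_ge0 ltW.
have KE : G + delta * K = K by rewrite /K; field; rewrite subr_eq0 gt_eqF.
pose V n := iter n bellman_op (fun=> 0).
have bV n : bounded_mfun (V n).
  elim: n => [|n]; first exact: bounded_mfun_cst.
  exact: bellman_op_bmfun.
have VK n p : `|V n p| <= K.
  elim: n p => [p|n IH p]; first by rewrite normr0.
  by rewrite -KE; exact: bellman_op_bound.
have Vcauchy p n k : `|V (n + k)%N p - V n p| <= K * delta ^+ n.
  rewrite /V iterD; apply: bellman_op_contract_iter.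
  - exact: bV.
  - exact: bounded_mfun_cst.
  - by move=> p'; rewrite subr0; exact: VK.
have /choice[Q QV] p := geometric_cauchy_cvg delta01 (Vcauchy p).
have bQ : bounded_mfun Q.
  split.
    by apply: (@measurable_fun_cvg _ _ _ _ V) => [n|p _]; [exact: (bV n).1|exact: (QV p).1].
  exists K => p; have := (QV p).2 0%N.
  by rewrite /V /= subr0 expr0 mulr1.
exists Q => // p; apply/eqP; rewrite -subr_eq0 -normr_le0.
apply: (geometric_le_lim (K := K * 2) delta01) => n; rewrite add0r.
rewrite (le_trans (ler_distD (V n.+1 p) _ _))//.
rewrite (_ : K * 2 * _ = K * delta ^+ n + K * delta ^+ n); last by ring.
have shrink : delta * (K * delta ^+ n) <= K * delta ^+ n.
  by rewrite ler_piMl ?(ltW delta1)// mulr_ge0// exprn_ge0.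
rewrite lerD//.
  by rewrite (le_trans ((QV p).2 n.+1))// exprS mulrCA.
apply: le_trans shrink; rewrite /V /=; apply: bellman_op_contract => // [|p'].
  exact: bV.
by rewrite distrC; exact: (QV p').2.
Qed.

End Bellman.

(** * The multilevel scheme: measurability and law *)

Section Scheme.
Context {d} {Omega : measurableType d} {R : realType} (P : probability Omega R).
Context (F : Theta -> set (set Omega)).
Hypotheses (Fsub : forall theta, sub_sigma (F theta)) (Findep : independent P F).
Context {dY} {Y : measurableType dY} {A : pointedType}.
Hypothesis finA : finite_set [set: A].

Local Notation point_type := (Y * discrete A)%type.

Variable xi : Theta -> point_type -> Omega -> Y.
Hypotheses (mxi : forall theta, field_mfun F [set theta] (xi theta))
  (xi_law : forall theta theta', same_law P (sample (xi theta)) (sample (xi theta'))).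
Arguments mxi : clear implicits.
Arguments xi_law : clear implicits.
Variables (g : point_type -> R) (G : R).
Hypotheses (mg : measurable_fun [set: point_type] g) (gG : forall p, `|g p| <= G).
Variables (delta : R) (M : nat).
Hypotheses (delta0 : 0 <= delta) (M0 : (0 < M)%N).

(** The double sum of the scheme as one sum over pairs (level, copy). *)
Definition keys (n : nat) : seq (nat * nat) :=
  [seq (l, i) | l <- index_iota 0 n, i <- index_iota 1 (M ^ (n - l)).+1].

Lemma keys_uniq n : uniq (keys n).
Proof.
by apply: allpairs_uniq_dep => //; [exact: iota_uniq|move=> l _; exact: iota_uniq|
  move=> [l i] [l' i'] _ _ [-> ->]].
Qed.

Lemma mem_keys n k : k \in keys n -> (k.1 < n)%N.
Proof.
by move=> /allpairsPdep[l [i [+ _ ->]]]; rewrite mem_index_iota => /andP[].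
Qed.

Lemma sum_keys n (f : nat -> nat -> R) :
  \sum_(k <- keys n) f k.1 k.2 =
  \sum_(0 <= l < n) \sum_(1 <= i < (M ^ (n - l)).+1) f l i.
Proof. by rewrite /keys big_allpairs_dep. Qed.

Lemma sum_keys_level n (f : nat -> R) :
  \sum_(k <- keys n) f k.1 = \sum_(0 <= l < n) M%:R ^+ (n - l) * f l.
Proof.
rewrite (sum_keys n (fun l _ => f l)); apply: eq_bigr => l _.
by rewrite sumr_const_nat subSS subn0 -natrX mulr_natl.
Qed.

Variable q : nat -> Theta -> point_type -> Omega -> R.

(** The zero field at level 0 replaces the indicator in front of the lagged term. *)
Definition lagged (l : nat) (theta : Theta) : point_type -> Omega -> R :=
  if l is l'.+1 then q l' theta else fun _ _ => 0.

Definition correction (theta : Theta) (k : nat * nat) : point_type -> Omega -> R :=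
  increment (xi (node theta k)) (q k.1 (node theta k)) (lagged k.1 (conode theta k)).

Definition weight (n l : nat) : R := delta / M%:R ^+ (n - l).

Hypothesis q_rec : forall n theta p w,
  q n theta p w = g p + \sum_(k <- keys n) weight n k.1 * correction theta k p w.

Lemma greedy_norm_le (W : point_type -> Omega -> R) K y w :
  (forall p, `|W p w| <= K) -> `|greedy W y w| <= K.
Proof. by move=> WK; apply: maxval_norm_le. Qed.

Lemma q_bounded n : exists K, forall theta p w, `|q n theta p w| <= K.
Proof.
suff [K [_ qK]] : exists K, 0 <= K /\
    forall m, (m < n.+1)%N -> forall theta p w, `|q m theta p w| <= K.
  by exists K => theta p w; exact: qK.
elim: n.+1 => [|m [K [K0 qK]]]; first by exists 0.
pose L := \sum_(k <- keys m) `|weight m k.1| * (K + K).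
have L0 : 0 <= L by apply: sumr_ge0 => k _; rewrite mulr_ge0// addr_ge0.
have G0 : 0 <= G by apply: le_trans (gG point); exact: normr_ge0.
exists (K + (G + L)); split; first by rewrite !addr_ge0.
move=> j; rewrite ltnS leq_eqVlt => /predU1P[-> theta p w|jm theta p w]; last first.
  by rewrite (le_trans (qK j jm _ _ _))// lerDl addr_ge0.
apply: (@le_trans _ _ (G + L)); last by rewrite lerDr.
rewrite q_rec (le_trans (ler_normD _ _))// lerD//.
rewrite (le_trans (ler_norm_sum _ _ _))// /L big_seq [leRHS]big_seq.
apply: ler_sum => k /mem_keys km; rewrite normrM ler_wpM2l//.
rewrite (le_trans (ler_normB _ _))// lerD//; apply: greedy_norm_le => p'.
  exact: qK.
by rewrite /lagged; case: k.1 km => [|l] lm; rewrite ?normr0//; apply: qK; exact: ltnW.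
Qed.

Lemma lagged_bounded l : exists K, forall theta p w, `|lagged l theta p w| <= K.
Proof.
case: l => [|l]; last exact: q_bounded.
by exists 0 => theta p w; rewrite normr0.
Qed.

(** Empty at level 0, where node and conode coincide, so that their subtrees are not
    disjoint. *)
Definition lag_support (theta : Theta) (k : nat * nat) : set Theta :=
  if k.1 is 0%N then set0 else below (conode theta k).

Lemma lag_support_branch theta k : lag_support theta k `<=` branch theta k.
Proof.
by rewrite /lag_support; case: k.1 => [//|_]; exact: below_conode_branch.
Qed.

Lemma node_notin_lag_support theta k :
  [set node theta k] `&` lag_support theta k = set0.
Proof.
rewrite /lag_support; case: k.1 => [|_]; first by rewrite setI0.
exact: node_notin_below_conode.
Qed.

Lemma below_lag_support theta k : below (node theta k) `&` lag_support theta k = set0.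
Proof.
rewrite /lag_support; case kl : k.1 => [|l]; first by rewrite setI0.
by apply: below_node_conode; rewrite kl.
Qed.

(** The scheme of index [theta] reads only the variables whose indices properly extend
    [theta]; this is what makes it independent of the state at [theta]. *)
Lemma q_mfun n theta : field_mfun F (below theta) (q n theta).
Proof.
elim/ltn_ind: n theta => n IH theta.
have mcorrection k : k \in keys n -> field_mfun F (branch theta k) (correction theta k).
  move=> /mem_keys kn; apply: field_mfun_increment => //.
  - by apply: (field_mfun_sub _ (mxi (node theta k))) => eta ->; exact: node_branch.
  - by apply: (field_mfun_sub _ (IH k.1 kn (node theta k))); exact: below_node_branch.
  - rewrite /lagged; case kl : k.1 kn => [|l] ln; first exact: measurable_cst.
    by apply: (field_mfun_sub _ (IH l (ltnW ln) (conode theta k))); exact: below_conode_branch.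
rewrite (_ : q n theta =
    fun p w => g p + \sum_(k <- keys n) weight n k.1 * correction theta k p w); last first.
  by apply/funext => p; apply/funext => w; exact: q_rec.
apply: measurable_funD; first exact: (measurableT_comp mg measurable_fst).
apply: (@field_mfun_sub _ _ _ _ _ _ _ _ _ (supports (branch theta) (keys n)) _
  (fun p w => \sum_(k <- keys n) weight n k.1 * correction theta k p w)).
  by move=> eta [k _]; exact: branch_below.
apply: field_mfun_sum => k kn.
by apply: measurable_funM; [exact: measurable_cst|exact: mcorrection].
Qed.
Arguments q_mfun : clear implicits.

Lemma lagged_mfun theta k :
  field_mfun F (lag_support theta k) (lagged k.1 (conode theta k)).
Proof.
rewrite /lagged /lag_support; case: k.1 => [|l]; first exact: measurable_cst.
exact: q_mfun.
Qed.
Arguments lagged_mfun : clear implicits.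

Lemma correction_mfun theta k : field_mfun F (branch theta k) (correction theta k).
Proof.
apply: field_mfun_increment => //.
- by apply: (field_mfun_sub _ (mxi (node theta k))) => eta ->; exact: node_branch.
- by apply: (field_mfun_sub _ (q_mfun k.1 (node theta k))); exact: below_node_branch.
- by apply: (field_mfun_sub _ (lagged_mfun theta k)); exact: lag_support_branch.
Qed.
Arguments correction_mfun : clear implicits.

(** For every index the field is built in the same way from independent ingredients whose
    laws are, by induction on the level, the same for every index. *)
Lemma q_law n theta theta' : same_law P (sample (q n theta)) (sample (q n theta')).
Proof.
elim/ltn_ind: n theta theta' => n IH theta theta'.
have corr_law k : k \in keys n ->
    same_law P (sample (correction theta k)) (sample (correction theta' k)).
  move=> /mem_keys kn.
  apply: (same_law_increment Fsub Findep finA (node_notin_below theta k)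
    (node_notin_lag_support theta k) (below_lag_support theta k)
    (node_notin_below theta' k)
    (node_notin_lag_support theta' k) (below_lag_support theta' k)
    (mxi _) (q_mfun _ _) (lagged_mfun _ _) (mxi _) (q_mfun _ _) (lagged_mfun _ _)
    (xi_law _ _)); first exact: IH.
  rewrite /lagged; case: k.1 kn => [|l] ln; first by [].
  by apply: IH; exact: ltnW.
have scaled_law k : k \in keys n ->
    same_law P (sample (fun p w => weight n k.1 * correction theta k p w))
               (sample (fun p w => weight n k.1 * correction theta' k p w)).
  move=> /corr_law; apply: (@same_law_image _ _ _ P _ _ _ _ _ _
    (fun u p => weight n k.1 * u p)) => p.
  by apply: measurable_funM => //; exact: measurable_eval.
have mscaled eta k : field_mfun F (branch eta k)
    (fun p w => weight n k.1 * correction eta k p w).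
  by apply: measurable_funM; [exact: measurable_cst|exact: correction_mfun].
have sum_law := same_law_sum Fsub Findep (keys_uniq n) (@disjoint_branches theta)
  (@disjoint_branches theta') (fun k _ => mscaled theta k)
  (fun k _ => mscaled theta' k) scaled_law.
have qE eta : sample (q n eta) = fun w p => g p +
    sample (fun p w => \sum_(k <- keys n) weight n k.1 * correction eta k p w) w p.
  by apply/funext => w; apply/funext => p; exact: q_rec.
rewrite !qE; apply: (@same_law_image _ _ _ P _ _ _ _ _ _ (fun u p => g p + u p)) sum_law => p.
by apply: measurable_funD => //; exact: measurable_eval.
Qed.
Arguments q_law : clear implicits.

(** * The mean of the scheme *)

Lemma greedy_bmfun S (W : point_type -> Omega -> R) K : field_mfun F S W ->
  (forall p w, `|W p w| <= K) ->
  bounded_mfun (fun z : Y * pooled_type F S => greedy W z.1 z.2).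
Proof.
move=> mW WK; split.
  exact: (measurable_greedy (S := S) finA mW measurable_fst measurable_snd).
by exists K => z; exact: greedy_norm_le.
Qed.

Definition value (l : nat) (y : Y) : R := Ex P (greedy (q l Theta0) y).

(** The greatest value over the actions is a functional of the path. *)
Lemma greedy_law l theta y : Ex P (greedy (q l theta) y) = value l y.
Proof.
have [K qK] := q_bounded l.
(* truncation makes the functional bounded on the whole path space, and changes
   nothing along the samples of the scheme *)
pose h (u : path_space point_type R) : R :=
  Num.max (- K) (Num.min K (maxval (fun b : A => u (argpair y b)))).
have hE eta : Ex P (greedy (q l eta) y) = Ex P (fun w => h (sample (q l eta) w)).
  congr Ex; apply/funext => w; rewrite /h.
  have := @greedy_norm_le (q l eta) K y w (fun p => qK eta p w).
  rewrite ler_norml => /andP[Kg gK].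
  by rewrite [Num.min _ _](min_idPr gK) (max_idPr Kg).
rewrite /value !hE; apply: q_law; split.
  apply: measurable_maxr; first exact: measurable_cst.
  apply: measurable_minr; first exact: measurable_cst.
  by apply: measurable_maxval => // b; exact: measurable_eval.
exists K => u; rewrite ler_norml /h le_max lexx ge_max ge_min lexx !andbT/=.
have K0 : 0 <= K by exact: le_trans (qK Theta0 point point).
by rewrite ge0_cp.
Qed.

Lemma Ex_state_bmfun S (H : Y * pooled_type F S -> R) : bounded_mfun H ->
  bounded_mfun (fun y => Ex P (fun w => H (y, w))).
Proof.
move=> bH; apply: (@bounded_mfun_Ex _ _ Y Omega R P (fun z => H (z.1, z.2))).
apply: (@bounded_mfun_comp R _ _ (Y * Omega)%type (Y * pooled_type F S)%type
  (fun z => (z.1, z.2)) H) bH.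
apply: measurable_fun_pair => //.
exact: (measurableT_comp (measurable_pooled_id Fsub (S := S))
  (measurable_snd : measurable_fun [set: Y * Omega] _)).
Qed.

Lemma value_bmfun l : bounded_mfun (value l).
Proof.
have [K qK] := q_bounded l.
exact: Ex_state_bmfun (greedy_bmfun (q_mfun l Theta0) (qK Theta0)).
Qed.

Lemma xi_mfun theta p : measurable_fun [set: Omega] (xi theta p).
Proof. exact: field_mfun_sample (mxi theta). Qed.

Lemma Ex_xi_law theta p (f : Y -> R) : bounded_mfun f ->
  Ex P (fun w => f (xi theta p w)) = Ex P (fun w => f (xi Theta0 p w)).
Proof.
move=> bf; apply: (xi_law theta Theta0 (fun u => f (u p))).
by apply: (@bounded_mfun_comp R _ _ (path_space point_type Y) Y (fun u => u p) f) bf;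
  exact: measurable_eval.
Qed.

(** The mean of the greatest value of the approximation at the next state, with the two
    sources of randomness already separated. *)
Definition mean_value (l : nat) (p : point_type) : R :=
  Ex P (fun w => value l (xi Theta0 p w)).

(** Freeze the state, replace each law by the one at [Theta0], and unfreeze. *)
Lemma Ex_greedy l theta theta' p : [set theta'] `&` below theta = set0 ->
  Ex P (fun w => greedy (q l theta) (xi theta' p w) w) = mean_value l p.
Proof.
move=> disj; have [K qK] := q_bounded l.
rewrite (Ex_state_decouple Fsub Findep p disj (mxi theta')
  (greedy_bmfun (q_mfun l theta) (qK theta))) /=.
under eq_fun do rewrite greedy_law.
by rewrite Ex_xi_law//; exact: value_bmfun.
Qed.

Definition lagged_mean (l : nat) (p : point_type) : R :=
  if l is l'.+1 then mean_value l' p else 0.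

Lemma bounded_mfun_xi_greedy S theta (W : point_type -> Omega -> R) K p :
  field_mfun F S W -> (forall p w, `|W p w| <= K) ->
  bounded_mfun (fun w => greedy W (xi theta p w) w).
Proof.
move=> mW WK; split.
  apply: (measurable_greedy (S := S) finA mW); first exact: xi_mfun.
  exact: measurable_pooled_id.
by exists K => w; exact: greedy_norm_le.
Qed.

Lemma correction_bmfun theta k p :
  @bounded_mfun _ (pooled_type F (branch theta k)) R (correction theta k p).
Proof.
split; first exact: field_mfun_pooled (correction_mfun theta k).
have [K qK] := q_bounded k.1; have [L lL] := lagged_bounded k.1.
by exists (K + L) => w; rewrite (le_trans (ler_normB _ _))// lerD//; exact: greedy_norm_le.
Qed.

Lemma Ex_correction theta k p :
  Ex P (correction theta k p) = mean_value k.1 p - lagged_mean k.1 p.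
Proof.
have [K qK] := q_bounded k.1; have [L lL] := lagged_bounded k.1.
rewrite /correction /increment ExB; last 2 first.
- exact: bounded_mfun_xi_greedy (q_mfun k.1 (node theta k)) (qK _).
- exact: bounded_mfun_xi_greedy (lagged_mfun theta k) (lL _).
rewrite Ex_greedy; last exact: node_notin_below.
congr (_ - _); rewrite /lagged /lagged_mean; case: k.1 => [|l].
  rewrite /greedy; under eq_fun do rewrite (maxval_cst finA).
  exact: Ex_cst.
by apply: Ex_greedy; exact: node_notin_below_conode.
Qed.

(** The weight delta / M^(n-l) is compensated by the M^(n-l) copies of level l. *)
Lemma telescope_levels n (f : nat -> R) :
  \sum_(k <- keys n.+1) weight n.+1 k.1 * (f k.1 - if k.1 is l.+1 then f l else 0) =
  delta * f n.
Proof.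
rewrite (sum_keys_level n.+1 (fun l => weight n.+1 l * (f l - if l is l.+1 then f l else 0))).
transitivity (\sum_(0 <= l < n.+1) delta * (f l - if l is l'.+1 then f l' else 0)).
  apply: eq_big_nat => l /andP[_ ln]; rewrite /weight mulrA; congr (_ * _).
  by rewrite mulrC divfK// expf_neq0// pnatr_eq0 -lt0n.
rewrite -big_distrr/=; congr (_ * _).
elim: n => [|n IH]; first by rewrite big_nat1 subr0.
by rewrite big_nat_recr//= IH addrC subrK.
Qed.

Lemma q_bmfun n theta p : bounded_mfun (q n theta p).
Proof.
split; first exact: field_mfun_sample (q_mfun n theta).
by have [K qK] := q_bounded n; exists K => w.
Qed.

(** The expectation of the scheme is one exact Bellman step applied to the previous
    level: the corrections telescope because, by [q_law], the value at a level does not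
    depend on the index. *)
Lemma Ex_q n theta p : Ex P (q n.+1 theta p) = g p + delta * mean_value n p.
Proof.
have -> : q n.+1 theta p =
    fun w => g p + \sum_(k <- keys n.+1) weight n.+1 k.1 * correction theta k p w.
  by apply/funext => w; exact: q_rec.
have bc k : bounded_mfun (correction theta k p).
  exact: (bounded_mfun_pooled Fsub (correction_bmfun theta k p)).
have bw k : bounded_mfun (fun w => weight n.+1 k.1 * correction theta k p w).
  exact: bounded_mfunZ.
rewrite ExD ?Ex_cst ?Ex_sum//; last 2 first.
- exact: bounded_mfun_cst.
- exact: bounded_mfun_sum.
congr (_ + _); rewrite -(telescope_levels n (mean_value ^~ p)).
by apply: eq_bigr => k _; rewrite ExZ// Ex_correction.
Qed.

(** * The mean square error of the scheme *)

Section Error.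
Variables (Q : point_type -> R) (KQ : R).
Hypotheses (mQ : measurable_fun [set: point_type] Q) (QK : forall p, `|Q p| <= KQ).

Hypothesis Q_eq : forall p, Q p = g p + delta * Ex P (fun w => best Q (xi Theta0 p w)).

Variables (actions : seq A) (u E : R).
Hypothesis actionsP : forall b : A, b \in actions.
Hypotheses (u0 : 0 < u) (u_half : u <= 2^-1) (delta_u : delta <= 1 - 2 * u)
  (u2E : u ^+ 2 = (size actions)%:R ^+ 2 / M%:R).
Hypotheses (E0 : 0 < E) (GE : G <= E) (GQE : G + KQ <= E).

Local Notation beta := (1 - u ^+ 2).

Let u_lt1 : 0 < 1 - u. Proof. by move: u_half; lra. Qed.

Let beta_gt0 : 0 < beta. Proof. by move: u0 u_half; nra. Qed.

Let size_actions_ge1 : 1 <= (size actions)%:R :> R.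
Proof.
rewrite (_ : 1 = 1%:R)// ler_nat.
by have := actionsP point; case: actions.
Qed.

Let MV0 : 0 < M%:R^-1 :> R. Proof. by rewrite invr_gt0 ltr0n. Qed.

Let rate n := E * beta ^+ n.

Let rate_gt0 n : 0 < rate n. Proof. by rewrite mulr_gt0// exprn_gt0. Qed.

Let dev n theta p w := `|q n theta p w - Q p|.

Let dev_mfun n theta : field_mfun F (below theta) (dev n theta).
Proof.
apply: measurableT_comp => //; apply: measurable_funB; first exact: (q_mfun n theta).
exact: (measurableT_comp mQ measurable_fst).
Qed.
Arguments dev_mfun : clear implicits.

Let dev_bounded n : exists K, forall theta p w, `|dev n theta p w| <= K.
Proof.
have [K qK] := q_bounded n; exists (K + KQ) => theta p w.
by rewrite normr_id (le_trans (ler_normB _ _))// lerD.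
Qed.

Let sq_error_le n := forall theta y,
  Ex P (fun w => greedy (dev n theta) y w ^+ 2) <= rate n ^+ 2.

Let greedy_dev_bmfun n theta y : bounded_mfun (greedy (dev n theta) y).
Proof.
have [K dK] := dev_bounded n.
apply: (bounded_mfun_pooled Fsub (S := below theta)).
exact: (bounded_mfun_section1 (greedy_bmfun (dev_mfun n theta) (dK theta)) y).
Qed.

Let dev_ge0 n theta y w : 0 <= greedy (dev n theta) y w.
Proof.
apply: le_trans (maxval_ge finA (fun b => dev n theta (argpair y b) w) point).
exact: normr_ge0.
Qed.

Let sq_error_at_state n theta theta' p : sq_error_le n ->
  [set theta'] `&` below theta = set0 ->
  Ex P (fun w => greedy (dev n theta) (xi theta' p w) w ^+ 2) <= rate n ^+ 2.
Proof.
move=> en disj; have [K dK] := dev_bounded n.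
have bH := bounded_mfun_sqr (greedy_bmfun (dev_mfun n theta) (dK theta)).
rewrite (Ex_state_decouple Fsub Findep p disj (mxi theta') bH) /=.
rewrite -[leRHS](Ex_cst P); apply: Ex_le => //; last exact: bounded_mfun_cst.
apply: (@bounded_mfun_comp R _ _ Omega Y (xi theta' p)) (Ex_state_bmfun bH).
exact: xi_mfun.
Qed.

(** A correction of positive level is a difference of two approximations of the same
    Bellman value, so it is bounded by the sum of their errors. At level 0 there is no
    cancellation, only the bound on [g], which [E] absorbs. *)
Let sq_correction_le theta k p : (forall m, (m <= k.1)%N -> sq_error_le m) ->
  Ex P (fun w => correction theta k p w ^+ 2) <= (rate k.1 * (1 + beta^-1)) ^+ 2.
Proof.
move=> err_k.
have bc := bounded_mfun_pooled Fsub (correction_bmfun theta k p).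
case: k err_k bc => -[|l] i /= err_k bc.
  rewrite -[leRHS](Ex_cst P); apply: Ex_le; [exact: bounded_mfun_sqr|exact: bounded_mfun_cst|].
  move=> w; rewrite -real_normK ?num_real// ler_pXn2r ?nnegrE//; last first.
    by rewrite mulr_ge0 ?(ltW (rate_gt0 _))// addr_ge0// invr_ge0 ltW.
  apply: (@le_trans _ _ G).
    rewrite /correction /increment /=.
    rewrite (_ : greedy (fun _ _ => 0) _ _ = 0) ?subr0; last exact: maxval_cst.
    by apply: greedy_norm_le => p'; rewrite q_rec big_nil addr0.
  rewrite /rate expr0 mulr1 (le_trans GE)// ler_peMr ?(ltW E0)//.
  by rewrite lerDl invr_ge0 ltW.
have dis1 := node_notin_below theta (l.+1, i).
have dis2 := node_notin_below_conode theta (l.+1, i).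
have [K dK] := dev_bounded l.+1; have [L dL] := dev_bounded l.
have bf := bounded_mfun_xi_greedy (node theta (l.+1, i)) p
  (dev_mfun l.+1 (node theta (l.+1, i))) (dK _).
have bh := bounded_mfun_xi_greedy (node theta (l.+1, i)) p
  (dev_mfun l (conode theta (l.+1, i))) (dL _).
have rateE : rate l.+1 * (1 + beta^-1) = rate l.+1 + rate l.
  by rewrite /rate exprS; field; rewrite gt_eqF.
rewrite rateE; apply: (le_trans _ (Ex_minkowski bf bh (ltW (rate_gt0 _)) (ltW (rate_gt0 _))
  (sq_error_at_state p (err_k _ (leqnn _)) dis1)
  (sq_error_at_state p (err_k _ (leqnSn _)) dis2))).
apply: Ex_le; [exact: bounded_mfun_sqr|exact/bounded_mfun_sqr/bounded_mfunD|move=> w].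
rewrite -real_normK ?num_real// ler_pXn2r ?nnegrE ?addr_ge0//.
rewrite /correction /increment /=; set y := xi _ p w.
have dist_best W : `|greedy W y w - best Q y| <= greedy (fun p' w' => `|W p' w' - Q p'|) y w.
  exact: maxval_dist.
rewrite (le_trans (ler_distD (best Q y) _ _))// lerD//.
by rewrite distrC; exact: dist_best.
Qed.

Let deviation n theta (k : nat * nat) p w : R :=
  weight n k.1 * (correction theta k p w - Ex P (correction theta k p)).

Let variance_bound n : R := \sum_(0 <= l < n)
  M%:R ^+ (n - l) * (weight n l * (rate l * (1 + beta^-1))) ^+ 2.

(** Independence over the branches makes the variance additive. *)
Let variance_le n theta p : (forall m, (m < n)%N -> sq_error_le m) ->
  Ex P (fun w => (q n theta p w - Ex P (q n theta p)) ^+ 2) <= variance_bound n.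
Proof.
move=> err_n.
have bc k := bounded_mfun_pooled Fsub (correction_bmfun theta k p).
have bc' k := correction_bmfun theta k p.
have bw k : bounded_mfun (fun w => weight n k.1 * correction theta k p w).
  exact: bounded_mfunZ.
have bdev k : @bounded_mfun _ (pooled_type F (branch theta k)) R (deviation n theta k p).
  by apply: bounded_mfunZ; apply: bounded_mfunB => //; exact: bounded_mfun_cst.
have qE : q n theta p = fun w => g p + \sum_(k <- keys n) weight n k.1 * correction theta k p w.
  by apply/funext => w; exact: q_rec.
have -> : (fun w => (q n theta p w - Ex P (q n theta p)) ^+ 2) =
    (fun w => (\sum_(k <- keys n) deviation n theta k p w) ^+ 2).
  apply/funext => w; congr (_ ^+ 2); rewrite qE ExD ?Ex_cst ?Ex_sum//; last 2 first.
  - exact: bounded_mfun_cst.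
  - exact: bounded_mfun_sum.
  rewrite opprD addrACA subrr add0r -sumrB; apply: eq_bigr => k _.
  by rewrite ExZ// -mulrBr.
rewrite (Ex_sqr_sum Fsub Findep (keys_uniq n) (@disjoint_branches theta) bdev); last first.
  move=> k; rewrite /deviation ExZ; last by apply: bounded_mfunB => //; exact: bounded_mfun_cst.
  by rewrite ExB ?Ex_cst ?subrr ?mulr0//; exact: bounded_mfun_cst.
rewrite /variance_bound -(sum_keys_level n
  (fun l => (weight n l * (rate l * (1 + beta^-1))) ^+ 2)) big_seq [leRHS]big_seq.
apply: ler_sum => k /mem_keys kn.
have bdk : bounded_mfun (fun w => correction theta k p w - Ex P (correction theta k p)).
  by apply: bounded_mfunB => //; exact: bounded_mfun_cst.
rewrite /deviation; under eq_fun do rewrite exprMn.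
rewrite ExZ; last exact: bounded_mfun_sqr.
rewrite [leRHS]exprMn ler_wpM2l ?sqr_ge0// (le_trans (variance_le_Ex_sqr P _))//.
by apply: sq_correction_le => m mk; apply: err_n; exact: leq_ltn_trans kn.
Qed.

Let spread n := delta * (E * beta ^+ n) * (2 * u / (1 - u)).

(** The geometric sum S satisfies (beta^2 - r) S <= r beta^(2n), and the denominator is at
    least (1 - u)^2. The factor |A| comes from bounding the maximum over the actions by
    the sum, and |A| / M <= u^2. *)
Let variance_bound_le n : (size actions)%:R * variance_bound n.+1 <= spread n ^+ 2.
Proof.
pose r : R := M%:R^-1.
have Mneq0 : M%:R != 0 :> R by rewrite pnatr_eq0 -lt0n.
pose S m := \sum_(0 <= l < m) r ^+ (m - l) * (beta ^+ 2) ^+ l.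
have SE m : (beta ^+ 2 - r) * S m = r * ((beta ^+ 2) ^+ m - r ^+ m).
  elim: m => [|m IH]; first by rewrite /S big_nil !expr0 subrr !mulr0.
  have -> : S m.+1 = r * S m + r * (beta ^+ 2) ^+ m.
    rewrite {1}/S big_nat_recr//= subSnn expr1; congr (_ + _).
    rewrite /S big_distrr/=; apply: eq_big_nat => l /andP[_ lm].
    by rewrite mulrA -exprS -subSn// ltnW.
  by rewrite mulrDr mulrCA IH !exprS; ring.
have -> : variance_bound n.+1 = delta ^+ 2 * E ^+ 2 * (1 + beta^-1) ^+ 2 * S n.+1.
  rewrite /variance_bound /S big_distrr/=; apply: eq_big_nat => l _.
  rewrite /weight /rate /r exprVn -exprM mulnC exprM.
  by field; rewrite ?expf_neq0// gt_eqF.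
have r0 : 0 < r by [].
have ru : r <= u ^+ 2.
  by rewrite u2E -/r ler_peMl ?(ltW r0)// exprn_ege1.
have sr : (size actions)%:R * r <= u ^+ 2.
  by rewrite u2E -/r ler_pM2r// expr2 ler_peMl.
have gap : (1 - u) ^+ 2 <= beta ^+ 2 - r.
  apply: (@le_trans _ _ (beta ^+ 2 - u ^+ 2)); last by rewrite lerB.
  rewrite -subr_ge0 (_ : _ - _ = 2 * u * (1 - 2 * u) + u ^+ 4); last by ring.
  rewrite addr_ge0 ?exprn_even_ge0// mulr_ge0//; first by rewrite mulr_ge0 ?ltW.
  by move: u_half; lra.
have gap0 : 0 < (1 - u) ^+ 2 by rewrite exprn_gt0.
have S_le : S n.+1 <= r * (beta ^+ 2) ^+ n.+1 / (1 - u) ^+ 2.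
  rewrite ler_pdivlMr//; apply: (@le_trans _ _ (S n.+1 * (beta ^+ 2 - r))).
    rewrite ler_wpM2l//; apply: sumr_ge0 => l _.
    by rewrite mulr_ge0 ?exprn_ge0 ?sqr_ge0// ltW.
  rewrite mulrC SE ler_wpM2l ?(ltW r0)// gerBl exprn_ge0// ltW//.
pose c := delta ^+ 2 * E ^+ 2 * (1 + beta^-1) ^+ 2 * (beta ^+ 2) ^+ n.+1 / (1 - u) ^+ 2.
have c0 : 0 <= c.
  by rewrite /c divr_ge0 ?sqr_ge0// !mulr_ge0 ?(ltW E0)// ?addr_ge0 ?invr_ge0
    ?(ltW beta_gt0)// exprn_ge0// sqr_ge0.
apply: (@le_trans _ _ (c * ((size actions)%:R * r))).
  rewrite (_ : c * _ = (size actions)%:R * (delta ^+ 2 * E ^+ 2 * (1 + beta^-1) ^+ 2 *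
    (r * (beta ^+ 2) ^+ n.+1 / (1 - u) ^+ 2))); last by rewrite /c; ring.
  by rewrite ler_wpM2l// ler_wpM2l// !mulr_ge0 ?(ltW E0)// addr_ge0// invr_ge0 ltW.
apply: (le_trans (ler_wpM2l c0 sr)).
have -> : c * u ^+ 2 = delta ^+ 2 * E ^+ 2 * (beta ^+ n) ^+ 2 *
    (u / (1 - u)) ^+ 2 * (1 + beta) ^+ 2.
  rewrite /c (_ : (beta ^+ 2) ^+ n.+1 = beta ^+ 2 * (beta ^+ n) ^+ 2); last first.
    by rewrite exprS -!exprM mulnC.
  by field; rewrite !gt_eqF.
have -> : spread n ^+ 2 = delta ^+ 2 * E ^+ 2 * (beta ^+ n) ^+ 2 *
    (u / (1 - u)) ^+ 2 * 2 ^+ 2.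
  by rewrite /spread; field; rewrite gt_eqF.
rewrite ler_wpM2l//.
  by rewrite !mulr_ge0 ?(ltW E0) ?exprn_ge0 ?invr_ge0 ?(ltW u0) ?(ltW u_lt1) ?(ltW beta_gt0).
rewrite ler_pXn2r ?nnegrE ?(addr_ge0 ler01 (ltW beta_gt0))//.
by rewrite (_ : 2 = 1 + 1)// lerD2l gerBl sqr_ge0.
Qed.

(** This is (1 - 2 u) (1 + u) / (1 - u) <= 1 - u^2, that is, 1 - 2 u <= (1 - u)^2. *)
Let rate_step n : spread n + delta * rate n <= rate n.+1.
Proof.
rewrite (_ : spread n + delta * rate n = rate n * (delta * ((1 + u) / (1 - u)))); last first.
  by rewrite /spread /rate; field; rewrite gt_eqF.
rewrite (_ : rate n.+1 = rate n * beta); last by rewrite /rate exprSr mulrA.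
rewrite ler_wpM2l ?(ltW (rate_gt0 _))//.
rewrite mulrA ler_pdivrMr//.
apply: (@le_trans _ _ ((1 - 2 * u) * (1 + u))).
  by rewrite ler_wpM2r// addr_ge0// ltW.
rewrite -subr_ge0 (_ : _ - _ = (1 + u) * u ^+ 2); last by ring.
by rewrite mulr_ge0 ?sqr_ge0// addr_ge0// ltW.
Qed.

Let bQ : bounded_mfun Q. Proof. by split; [|exists KQ]. Qed.

Let value_error_le n y : sq_error_le n -> `|value n y - best Q y| <= rate n.
Proof.
move=> en.
have bq : bounded_mfun (greedy (q n Theta0) y).
  have [K qK] := q_bounded n; apply: (bounded_mfun_pooled Fsub (S := below Theta0)).
  exact: (bounded_mfun_section1 (greedy_bmfun (q_mfun n Theta0) (qK Theta0)) y).
have bd := greedy_dev_bmfun n Theta0 y.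
have bqb : bounded_mfun (fun w => greedy (q n Theta0) y w - best Q y).
  by apply: bounded_mfunB => //; exact: bounded_mfun_cst.
rewrite /value -[X in _ - X](Ex_cst P) -ExB//; last exact: bounded_mfun_cst.
apply: (le_trans (norm_Ex_le P bqb)).
apply: (@le_trans _ _ (Ex P (greedy (dev n Theta0) y))).
  by apply: Ex_le => //; [exact: bounded_mfun_norm|move=> w; exact: maxval_dist].
rewrite -(@ler_pXn2r _ 2) ?nnegrE ?(ltW (rate_gt0 _))//; last exact: Ex_ge0.
exact: le_trans (Ex_sqr_le P bd) (en _ _).
Qed.

(** By [Ex_q] the bias is delta times the mean error of the previous level at the next
    state. *)
Let bias_le n theta p : sq_error_le n ->
  `|Ex P (q n.+1 theta p) - Q p| <= delta * rate n.
Proof.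
move=> en.
have bv : bounded_mfun (fun w => value n (xi Theta0 p w)).
  by apply: (@bounded_mfun_comp R _ _ Omega Y (xi Theta0 p)) (value_bmfun n); exact: xi_mfun.
have bb : bounded_mfun (fun w => best Q (xi Theta0 p w)).
  by apply: (@bounded_mfun_comp R _ _ Omega Y (xi Theta0 p)) (best_bmfun finA bQ);
    exact: xi_mfun.
rewrite Ex_q Q_eq opprD addrACA subrr add0r -mulrBr normrM ger0_norm// ler_wpM2l//.
rewrite /mean_value -ExB//; apply: Ex_norm_le; first exact: bounded_mfunB.
by move=> w; exact: value_error_le.
Qed.

Lemma sq_error_bmfun n theta y :
  bounded_mfun (fun w => maxval (fun b : A =>
    `|Q (argpair y b) - q n theta (argpair y b) w| ^+ 2)).
Proof.
have [K qK] := q_bounded n.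
apply: (bounded_mfun_maxval (K := (KQ + K) ^+ 2)) => // [b|b w].
  apply: (bounded_mfun_sqr _).1; apply: bounded_mfun_norm; apply: bounded_mfunB.
    exact: bounded_mfun_cst.
  exact: q_bmfun.
rewrite ger0_norm ?sqr_ge0// ler_pXn2r ?nnegrE//.
  by rewrite (le_trans (ler_normB _ _))// lerD.
by rewrite (le_trans _ (lerD (QK point) (qK theta point w)))// addr_ge0.
Qed.

(** Geometric decay of the mean square error, uniformly in the state: the deviation from
    the mean and the bias are added by Minkowski's inequality. *)
Lemma scheme_error n theta y :
  Ex P (fun w => maxval (fun b : A => `|Q (argpair y b) - q n theta (argpair y b) w| ^+ 2)) <=
  (E * beta ^+ n) ^+ 2.
Proof.
suff err : sq_error_le n.
  apply: le_trans (err theta y).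
  apply: Ex_le; [exact: sq_error_bmfun|exact/bounded_mfun_sqr/greedy_dev_bmfun|].
  move=> w; apply: maxval_le => // b; rewrite ler_pXn2r ?nnegrE//.
  by rewrite distrC; exact: (maxval_ge finA (fun b => dev n theta (argpair y b) w)).
elim/ltn_ind: n => -[_|n IH] {}theta {}y.
  rewrite -[leRHS](Ex_cst P); apply: Ex_le.
  - exact/bounded_mfun_sqr/greedy_dev_bmfun.
  - exact: bounded_mfun_cst.
  - move=> w; rewrite ler_pXn2r ?nnegrE ?(ltW (rate_gt0 _))// /rate expr0 mulr1.
    apply: le_trans GQE; apply: maxval_le => // b.
    by rewrite (le_trans (ler_normB _ _))// lerD// q_rec big_nil addr0.
pose Z b w := q n.+1 theta (argpair y b) w - Ex P (q n.+1 theta (argpair y b)).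
have bZ b : bounded_mfun (Z b).
  by apply: bounded_mfunB; [exact: q_bmfun|exact: bounded_mfun_cst].
have en : sq_error_le n by exact: IH.
pose Zmax w := maxval (fun b => `|Z b w|).
have [K qK] := q_bounded n.+1.
have bZmax : bounded_mfun Zmax.
  apply: (bounded_mfun_maxval (K := K + K)) => // [b|b w].
    exact: (bounded_mfun_norm (bZ b)).1.
  rewrite normr_id (le_trans (ler_normB _ _))// lerD//.
  by apply: Ex_norm_le; [exact: q_bmfun|move=> w'].
have Zmax_le : Ex P (fun w => Zmax w ^+ 2) <= spread n ^+ 2.
  have bZ2 b := bounded_mfun_sqr (bZ b).
  apply: (@le_trans _ _ (Ex P (fun w => \sum_(b <- actions) Z b w ^+ 2))).
    apply: Ex_le; [exact: bounded_mfun_sqr|exact: bounded_mfun_sum|move=> w].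
    rewrite /Zmax; have [b [-> _]] := maxval_attained finA (fun b => `|Z b w|).
    rewrite real_normK ?num_real//.
    move: (actionsP b); elim: actions => //= c s IHs; rewrite inE big_cons.
    move=> /predU1P[->|/IHs Zs]; first by rewrite lerDl sumr_ge0// => *; rewrite sqr_ge0.
    by rewrite (le_trans Zs)// lerDr sqr_ge0.
  rewrite Ex_sum//; apply: le_trans (variance_bound_le n).
  apply: (@le_trans _ _ (\sum_(b <- actions) variance_bound n.+1)).
    by apply: ler_sum => b _; apply: variance_le => m mn; exact: IH.
  by rewrite big_const_seq count_predT iter_addr_0 mulr_natl.
have spread0 : 0 <= spread n.
  by rewrite /spread !mulr_ge0 ?(ltW E0) ?exprn_ge0 ?invr_ge0 ?(ltW u0) ?(ltW u_lt1)
    ?(ltW beta_gt0).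
have bias0 : 0 <= delta * rate n by rewrite mulr_ge0// ltW.
have bias2 : Ex P (fun=> (delta * rate n) ^+ 2) <= (delta * rate n) ^+ 2 by rewrite Ex_cst.
have bB := bounded_mfun_cst (T := Omega) (delta * rate n).
apply: (@le_trans _ _ ((spread n + delta * rate n) ^+ 2)); last first.
  rewrite ler_pXn2r ?nnegrE ?addr_ge0 ?(ltW (rate_gt0 _))//; exact: rate_step.
apply: (le_trans _ (Ex_minkowski bZmax bB spread0 bias0 Zmax_le bias2)).
apply: Ex_le; [exact/bounded_mfun_sqr/greedy_dev_bmfun|exact/bounded_mfun_sqr/bounded_mfunD|].
move=> w.
have Zmax0 : 0 <= Zmax w by apply: le_trans (maxval_ge finA _ point); exact: normr_ge0.
rewrite ler_pXn2r ?nnegrE ?addr_ge0//.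
apply: maxval_le => // b.
rewrite /dev (le_trans (ler_distD (Ex P (q n.+1 theta (argpair y b))) _ _))// lerD//.
  exact: (maxval_ge finA (fun b => `|Z b w|)).
exact: bias_le.
Qed.

End Error.
End Scheme.

(** * Cost, and the level for a given accuracy *)

(** The stronger bound rho M^n (3^n - 1) is what the recursion preserves: divided by
    rho M^n, level l contributes at most 1 + 2 (3^l - 1) <= 3^(l+1) - 3^l, and these
    differences telescope. *)
Lemma cost_le {R : realType} (M : nat) (rho : R) (C : nat -> R) : 0 <= rho -> (0 < M)%N ->
  (forall n, C n <= \sum_(0 <= l < n)
     M%:R ^+ (n - l) * (rho + C l + C l.-1 * (0 < l)%N%:R)) ->
  forall n, C n <= rho * (3 * M%:R) ^+ n.
Proof.
move=> rho0 M0 C_rec.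
have M1 : 1 <= M%:R :> R by rewrite ler1n.
pose B n : R := rho * M%:R ^+ n * (3 ^+ n - 1).
have pow31 n : 1 <= 3 ^+ n :> R by rewrite exprn_ege1// ler1n.
have B0 n : 0 <= B n by rewrite /B !mulr_ge0 ?exprn_ge0 ?subr_ge0.
have Bmono n : B n <= B n.+1.
  rewrite /B ler_pM ?mulr_ge0 ?exprn_ge0 ?subr_ge0//.
    by rewrite ler_wpM2l// ler_weXn2l.
  by rewrite lerB// ler_weXn2l// ler1n.
suff CB n : C n <= B n.
  move=> n; rewrite (le_trans (CB n))// /B exprMn -subr_ge0.
  rewrite (_ : _ - _ = rho * M%:R ^+ n); last by ring.
  by rewrite mulr_ge0// exprn_ge0.
elim/ltn_ind: n => n IH.
apply: (@le_trans _ _ (\sum_(0 <= l < n) rho * M%:R ^+ n * (3 ^+ l.+1 - 3 ^+ l))).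
  apply: (le_trans (C_rec n)); rewrite big_nat [leRHS]big_nat.
  apply: ler_sum => l /andP[_ ln].
  rewrite (_ : rho * M%:R ^+ n * _ =
    M%:R ^+ (n - l) * (rho * M%:R ^+ l * (2 * 3 ^+ l))); last first.
    by rewrite -{1}(subnK (ltnW ln)) exprD exprS; ring.
  rewrite ler_wpM2l ?exprn_ge0//.
  have rhoM : rho <= rho * M%:R ^+ l by rewrite ler_peMr// exprn_ege1.
  have Cl : C l <= B l by exact: IH.
  have Cl' : C l.-1 * (0 < l)%N%:R <= B l.
    case: l ln {rhoM Cl} => [|l] ln /=; first by rewrite mulr0.
    by rewrite mulr1 (le_trans _ (Bmono l))// IH// ltnW.
  apply: (@le_trans _ _ (rho * M%:R ^+ l + B l + B l)); first by rewrite !lerD.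
  rewrite -subr_ge0 (_ : _ - _ = rho * M%:R ^+ l); last by rewrite /B; ring.
  by rewrite mulr_ge0// exprn_ge0.
by rewrite -big_distrr/= telescope_sumr// expr0.
Qed.

(** The level is logarithmic in 1/eps, so a cost exponential in the level is a power of
    1/eps. It exceeds the real solution x of E beta^x = eps by at most one, which is
    the extra factor [D] in the constant. *)
Lemma level_choice {R : realType} (E beta D : R) : 1 <= E -> 0 < beta < 1 -> 1 <= D ->
  exists (N : R -> nat) (c : R), forall eps : R, 0 < eps <= 1 ->
    [/\ (0 < N eps)%N, E * beta ^+ N eps <= eps & D ^+ N eps <= c * eps `^ (- c)].
Proof.
move=> E1 /andP[beta0 beta1] D1.
have E0 : 0 < E by exact: lt_le_trans ltr01 E1.
have D0 : 0 < D by exact: lt_le_trans ltr01 D1.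
pose b := - ln beta.
have b0 : 0 < b by rewrite oppr_gt0 ln_lt0// beta0.
pose N eps := (Num.trunc (ln (E / eps) / b)).+1.
pose p := ln D / b.
have p0 : 0 <= p by rewrite divr_ge0 ?ln_ge0// ltW.
have DEp0 : 0 <= D * E `^ p by rewrite mulr_ge0 ?powR_ge0// ltW.
exists N, (p + D * E `^ p) => eps /andP[eps0 eps1].
have ratio_ge1 : 1 <= E / eps by rewrite ler_pdivlMr// mul1r (le_trans eps1).
have ratio0 : 0 < E / eps by exact: lt_le_trans ltr01 ratio_ge1.
have x0 : 0 <= ln (E / eps) / b by rewrite divr_ge0 ?ln_ge0// ltW.
split=> //.
  have := truncnS_gt (ln (E / eps) / b); rewrite -/(N eps) ltr_pdivrMr// => /ltW xN.
  have EN : E / eps <= expR ((N eps)%:R * b).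
    by rewrite -[leLHS]lnK ?posrE// ler_expR.
  have -> : beta ^+ N eps = (expR ((N eps)%:R * b))^-1.
    by rewrite -expRN mulrN opprK expRM_natl lnK.
  by rewrite ler_pdivrMr ?expR_gt0// mulrC -ler_pdivrMr.
have N_le : (N eps).-1%:R <= ln (E / eps) / b.
  by have /andP[] := truncn_itv x0.
have powD : D ^+ (N eps).-1 <= E `^ p * eps `^ (- p).
  rewrite -[D in D ^+ _]lnK// -expRM_natl.
  rewrite /powR (gt_eqF E0) (gt_eqF eps0) -expRD ler_expR.
  have -> : p * ln E + - p * ln eps = ln D * (ln (E / eps) / b).
    by rewrite ln_div ?posrE// /p; ring.
  by rewrite mulrC ler_wpM2l// ln_ge0.
have le_pow : eps `^ (- p) <= eps `^ (- (p + D * E `^ p)).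
  rewrite /powR (gt_eqF eps0) ler_expR !mulNr lerN2 ler_wnM2r ?lerDl//.
  by rewrite ln_le0.
rewrite (_ : N eps = (N eps).-1.+1)// exprS.
apply: (le_trans (ler_wpM2l (ltW D0) powD)); rewrite mulrA.
apply: ler_pM => //; first exact: powR_ge0.
by rewrite lerDr.
Qed.

(** * The Euclidean state space and the theorem *)

Section Dimension.
Context {R : realType} {A : pointedType} {disp : measure_display}
  {Omega : measurableType disp} (P : probability Omega R) {dim : nat}.
Hypothesis finA : finite_set [set: A].

Local Notation state := (borel_rV R dim).
Local Notation point_type := (state * discrete A)%type.

Definition uncurried {T : Type} (f : 'rV[R]_dim -> A -> T) (p : point_type) : T :=
  f p.1 p.2.

Variables (F : Theta -> set (set Omega)).
Hypotheses (Fsub : forall theta, sub_sigma (F theta)) (Findep : independent P F).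
Variable X : Theta -> 'rV[R]_dim -> A -> Omega -> 'rV[R]_dim.
Hypothesis X_meas : forall theta,
  measurable_fun
    [set: borel_rV R dim * discrete A * g_sigma_algebraType (F theta)]
    (fun p : borel_rV R dim * discrete A * g_sigma_algebraType (F theta) =>
       X theta p.1.1 p.1.2 p.2 : borel_rV R dim).
Hypothesis X_iid : iid_fields P (fun (theta : Theta) (w : Omega) (xa : 'rV[R]_dim * A) =>
  X theta xa.1 xa.2 w : borel_rV R dim).

Definition transition (theta : Theta) : point_type -> Omega -> state := uncurried (X theta).

Lemma transition_mfun theta : field_mfun F [set theta] (transition theta).
Proof.
have mid : measurable_fun [set: pooled_type F [set theta]]
    (fun w : pooled_type F [set theta] => w : g_sigma_algebraType (F theta)).
  move=> _ B mB; rewrite setTI; apply: sub_sigma_algebra2 mB => C FC.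
  by exists theta.
exact: (measurableT_comp (@X_meas theta) (measurable_fun_pair
  (measurable_fst : measurable_fun [set: point_type * pooled_type F [set theta]] _)
  (measurableT_comp mid
    (measurable_snd : measurable_fun [set: point_type * pooled_type F [set theta]] _)))).
Qed.
Arguments transition_mfun : clear implicits.

Lemma transition_law theta theta' :
  same_law P (sample (transition theta)) (sample (transition theta')).
Proof.
apply: same_law_of_events.
- by move=> p; exact: (field_mfun_sample Fsub p (transition_mfun theta)).
- by move=> p; exact: (field_mfun_sample Fsub p (transition_mfun theta')).
- exact: X_iid.2.
Qed.

Lemma transition_joint : measurable_fun [set: point_type * Omega]
  (fun z => transition Theta0 z.1 z.2).
Proof. exact: (field_mfun_joint Fsub (transition_mfun Theta0)). Qed.

Variables (g : 'rV[R]_dim -> A -> R) (delta : R).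

Lemma bellman_solutionP (Q : 'rV[R]_dim -> A -> R) :
  bellman_solution P g delta (X Theta0) Q <->
  bounded_mfun (uncurried Q) /\ forall p, uncurried Q p =
    bellman_op P (transition Theta0) (uncurried g) delta (uncurried Q) p.
Proof.
have next_value p : bounded_mfun (uncurried Q) ->
    'E_P[fun w => maxval (fun b => Q (X Theta0 p.1 p.2 w) b)]%E =
    (Ex P (fun w => best (uncurried Q) (transition Theta0 p w)))%:E.
  move=> bQ; apply: expectationE.
  exact: (next_best_bmfun finA transition_joint p bQ).
split=> [[mQ [K QK] Q_eq]|[bQ Q_eq]].
  have bQ : bounded_mfun (uncurried Q) by split => //; exists K => p; exact: QK.
  split=> // p; have := Q_eq p.1 p.2.
  by rewrite (next_value p bQ) -EFinM -EFinD => -[].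
have [mQ [K QK]] := bQ; split=> //; first by exists K => x a; exact: (QK (x, a)).
move=> x a; rewrite (next_value (x, a) bQ) -EFinM -EFinD; congr (_%:E).
exact: (Q_eq (x, a)).
Qed.

Variables (G : R) (M : nat) (Qn : nat -> Theta -> 'rV[R]_dim -> A -> Omega -> R).
Hypotheses (g_meas : measurable_field g) (gG : forall x a, `|g x a| <= G)
  (delta01 : 0 <= delta < 1) (M0 : (0 < M)%N).
Hypothesis Qn_rec : forall n theta x a w,
  Qn n theta x a w = g x a +
      \sum_(0 <= l < n) delta / M%:R ^+ (n - l) *
        \sum_(1 <= i < (M ^ (n - l)).+1)
          (maxval (fun b =>
             Qn l (Theta_cat theta l%:Z i%:Z)
               (X (Theta_cat theta l%:Z i%:Z) x a w) b w)
           - (0 < l)%N%:R * maxval (fun b =>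
             Qn l.-1 (Theta_cat theta (- l%:Z) i%:Z)
               (X (Theta_cat theta l%:Z i%:Z) x a w) b w)).

Lemma bellman_unique_solution :
  exists! Q : 'rV[R]_dim -> A -> R, bellman_solution P g delta (X Theta0) Q.
Proof.
have gG' (p : point_type) : `|uncurried g p| <= G by exact: gG.
have [Q bQ Q_eq] := bellman_exists P finA transition_joint g_meas gG' delta01.
exists (fun x a => Q (x, a)).
have uncurriedE : uncurried (fun x a => Q (x, a)) = Q by apply/funext => -[].
split; first by apply/bellman_solutionP; rewrite uncurriedE.
move=> Q' /bellman_solutionP[bQ' Q'_eq].
have QQ' := bellman_unique finA transition_joint g_meas gG' delta01 bQ bQ' Q_eq Q'_eq.
by rewrite QQ'; apply/funext => x; apply/funext => a.
Qed.

Definition scheme n theta : point_type -> Omega -> R := uncurried (Qn n theta).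

Lemma scheme_rec n theta p w : scheme n theta p w = uncurried g p +
  \sum_(k <- keys M n) weight delta M n k.1 * correction transition scheme theta k p w.
Proof.
rewrite /scheme /uncurried Qn_rec; congr (_ + _).
rewrite (sum_keys M n (fun l i =>
  weight delta M n l * correction transition scheme theta (l, i) p w)).
apply: eq_bigr => l _; rewrite big_distrr/=; apply: eq_bigr => i _.
congr (_ * (_ - _)); case: l => [|l]; last by rewrite mul1r.
by rewrite mul0r /greedy maxval_cst.
Qed.

Variables (actions : seq A) (u E : R).
Hypotheses (actionsP : forall b : A, b \in actions) (u0 : 0 < u) (u_half : u <= 2^-1)
  (delta_u : delta <= 1 - 2 * u) (u2E : u ^+ 2 = (size actions)%:R ^+ 2 / M%:R)
  (E0 : 0 < E) (GE : G <= E) (GQE : G + G / (2 * u) <= E).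

Lemma L2_error_le (Q : 'rV[R]_dim -> A -> R) n x eps :
  bellman_solution P g delta (X Theta0) Q -> 0 < eps -> E * (1 - u ^+ 2) ^+ n <= eps ->
  ('E_P[fun w => maxval (fun a =>
      (`|Q x a - Qn n Theta0 x a w| ^+ 2)%R)] `^ (2^-1)%R <= eps%:E)%E.
Proof.
move=> /bellman_solutionP[bQ Q_eq] eps0 Eeps.
have gG' (p : point_type) : `|uncurried g p| <= G by exact: gG.
have G0 : 0 <= G by exact: le_trans (gG 0 point).
have QK p : `|uncurried Q p| <= G / (2 * u).
  apply: (le_trans (bellman_bound finA transition_joint gG' delta01 bQ Q_eq p)).
  have u20 : 0 < 2 * u by rewrite mulr_gt0.
  rewrite ler_wpM2l// lef_pV2 ?posrE//; last by move: delta_u; lra.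
  by move: delta_u u0; lra.
have /andP[delta0 _] := delta01.
have be := sq_error_bmfun Fsub finA transition_mfun g_meas gG' scheme_rec QK n Theta0 x.
have := scheme_error Fsub Findep finA transition_mfun transition_law g_meas gG' delta0 M0
  scheme_rec bQ.1 QK Q_eq actionsP u0 u_half delta_u u2E E0 GE GQE n Theta0 x.
set err := (fun w => _) in be *; rewrite -/err => err_le.
rewrite (expectationE P be : 'E_P[fun w => maxval (fun a =>
      (`|Q x a - Qn n Theta0 x a w| ^+ 2)%R)]%E = _).
rewrite poweR_EFin lee_fin.
have err0 : 0 <= Ex P err.
  apply: Ex_ge0 => w; apply: le_trans (maxval_ge finA _ point); exact: exprn_ge0.
rewrite powR12_sqrt//; apply: (@le_trans _ _ (Num.sqrt (eps ^+ 2))); last first.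
  by rewrite sqrtr_sqr ger0_norm// ltW.
rewrite ler_wsqrtr//; apply: (le_trans err_le); rewrite ler_pXn2r ?nnegrE ?(ltW eps0)//.
rewrite mulr_ge0 ?(ltW E0)// exprn_ge0// subr_ge0.
by rewrite expr_le1 ?(ltW u0)//; move: u_half; lra.
Qed.

End Dimension.

Theorem theorem1p1 (R : realType) (A : pointedType)
  (disp : measure_display) (Omega : measurableType disp)
  (P : probability Omega R)
  (g : forall d : nat, 'rV[R]_d -> A -> R)
  (F : nat -> Theta -> set (set Omega))
  (X : forall d : nat, Theta -> 'rV[R]_d -> A -> Omega -> 'rV[R]_d)
  (delta Rc : nat -> R) (M : nat)
  (Qn : forall d : nat, nat -> Theta -> 'rV[R]_d -> A -> Omega -> R)
  (C : nat -> nat -> R)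
  (g_meas : forall d : nat, (0 < d)%N -> measurable_field (g d))
  (g_bounded :
    (ereal_sup [set y | exists d (x : 'rV[R]_d) (a : A),
                          (0 < d)%N /\ y = `|g d x a|%:E] < +oo)%E)
  (F_sub : forall (d : nat) (theta : Theta), (0 < d)%N -> sub_sigma (F d theta))
  (F_indep : forall d : nat, (0 < d)%N -> independent P (F d))
  (X_meas : forall (d : nat) (theta : Theta), (0 < d)%N ->
    measurable_fun
      [set: borel_rV R d * discrete A * g_sigma_algebraType (F d theta)]
      (fun p : borel_rV R d * discrete A * g_sigma_algebraType (F d theta) =>
         X d theta p.1.1 p.1.2 p.2 : borel_rV R d))
  (X_iid : forall d : nat, (0 < d)%N ->
    iid_fields P (fun (theta : Theta) (w : Omega) (xa : 'rV[R]_d * A) =>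
                    X d theta xa.1 xa.2 w : borel_rV R d))
  (delta_range : forall d : nat, (0 < d)%N -> 0 <= delta d < 1)
  (Rc_ge0 : forall d : nat, (0 < d)%N -> 0 <= Rc d)
  (M_gt0 : (0 < M)%N)
  (M_ge : (ereal_sup [set 4%:E * counting [set: A] ^+ 2
                            * ((1 - delta d) ^- 2)%:E
                      | d in [set d : nat | (0 < d)%N]] <= M%:R%:E)%E)
  (Qn_rec : forall (d n : nat) (theta : Theta) (x : 'rV[R]_d) (a : A)
                   (w : Omega), (0 < d)%N ->
    Qn d n theta x a w = g d x a +
      \sum_(0 <= l < n) delta d / M%:R ^+ (n - l) *
        \sum_(1 <= i < (M ^ (n - l)).+1)
          (maxval (fun b =>
             Qn d l (Theta_cat theta l%:Z i%:Z)
               (X d (Theta_cat theta l%:Z i%:Z) x a w) b w)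
           - (0 < l)%N%:R * maxval (fun b =>
             Qn d l.-1 (Theta_cat theta (- l%:Z) i%:Z)
               (X d (Theta_cat theta l%:Z i%:Z) x a w) b w)))
  (C_ge0 : forall d n : nat, (0 < d)%N -> 0 <= C d n)
  (C_rec : forall d n : nat, (0 < d)%N ->
    C d n <= \sum_(0 <= l < n)
      M%:R ^+ (n - l) * (Rc d + C d l + C d l.-1 * (0 < l)%N%:R)) :
  (forall d : nat, (0 < d)%N ->
     exists! Q : 'rV[R]_d -> A -> R,
       bellman_solution P (g d) (delta d) (X d Theta0) Q) /\
  (forall Q : (forall d : nat, 'rV[R]_d -> A -> R),
     (forall d : nat, (0 < d)%N ->
        bellman_solution P (g d) (delta d) (X d Theta0) (Q d)) ->
     exists (N : R -> nat) (c : R),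
       (forall eps : R, 0 < eps <= 1 -> (0 < N eps)%N) /\
       forall (d : nat) (eps : R), (0 < d)%N -> 0 < eps <= 1 ->
         C d (N eps) <= c * Rc d * eps `^ (- c) /\
         (ereal_sup
            [set ('E_P[fun w => maxval (fun a =>
                    (`|Q d x a - Qn d (N eps) Theta0 x a w| ^+ 2)%R)])
                  `^ (2^-1)%R
             | x in [set: 'rV[R]_d]] <= eps%:E)%E).
Proof.
pose actions : seq A := finmap.enum_fset (fset_set [set: A]).
have [finA card_le] : finite_set [set: A] /\ forall d, (0 < d)%N ->
    4 * (size actions)%:R ^+ 2 * (1 - delta d) ^- 2 <= M%:R :> R.
  have M_ge_d d : (0 < d)%N ->
      (4%:E * counting [set: A] ^+ 2 * ((1 - delta d) ^- 2)%:E <= M%:R%:E :> \bar R)%E.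
    by move=> d0; apply: le_trans M_ge; apply: ereal_sup_ubound; exists d.
  have inv0 d : (0 < d)%N -> 0 < (1 - delta d) ^- 2.
    by move=> /delta_range/andP[_ d1]; rewrite invr_gt0 exprn_gt0// subr_gt0.
  have [finA|infA] := pselect (finite_set [set: A]); last first.
    have := M_ge_d 1%N isT; rewrite /counting asboolF// expe2 mulyy.
    by rewrite gt0_muley ?lte_fin// gt0_mulye ?lte_fin ?inv0// leNgt ltry.
  split=> // d d0.
  by have := M_ge_d d d0; rewrite /counting asboolT// -EFin_expe -!EFinM lee_fin.
have actionsP b : b \in actions.
  by have := in_fset_set finA b; rewrite in_setT.
have actions0 : 0 < (size actions)%:R :> R.
  by rewrite ltr0n; have := actionsP point; rewrite lt0n size_eq0; apply: contraTneq => ->.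
have M0 : 0 < M%:R :> R by rewrite ltr0n.
(* uniform in the dimension: every [1 - delta d] is at least [2 * u] *)
pose u : R := (size actions)%:R / Num.sqrt M%:R.
have u0 : 0 < u by rewrite divr_gt0// sqrtr_gt0.
have u2E : u ^+ 2 = (size actions)%:R ^+ 2 / M%:R.
  by rewrite /u expr_div_n sqr_sqrtr// ltW.
have delta_u d : (0 < d)%N -> delta d <= 1 - 2 * u.
  move=> d0; have /andP[_ d1] := delta_range d d0.
  have gap0 : 0 < 1 - delta d by rewrite subr_gt0.
  suff : 2 * u <= 1 - delta d by lra.
  rewrite -(@ler_pXn2r _ 2) ?nnegrE ?(ltW gap0) ?mulr_ge0 ?(ltW u0)//.
  rewrite exprMn u2E mulrA ler_pdivrMr//.
  have := card_le d d0; rewrite ler_pdivrMr ?exprn_gt0// [X in _ <= X]mulrC.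
  by rewrite (_ : 2 ^+ 2 = 4 :> R)// -natrX.
have u_half : u <= 2^-1.
  by have := delta_u 1%N isT; have /andP[] := delta_range 1%N isT; lra.
have [G gG] : exists G, forall d x a, (0 < d)%N -> `|g d x a| <= G.
  set S := (X in ereal_sup X) in g_bounded.
  have S_ub d x a : (0 < d)%N -> (`|g d x a|%:E <= ereal_sup S)%E.
    by move=> d0; apply: ereal_sup_ubound; exists d, x, a.
  exists (fine (ereal_sup S)) => d x a d0; rewrite -lee_fin fineK; first exact: S_ub.
  rewrite ge0_fin_numE//; apply: le_trans (S_ub d x a d0).
  by rewrite lee_fin.
have G0 : 0 <= G by apply: le_trans (gG 1%N 0 point isT).
split=> [d d0|Q Q_sol].
  exact: (bellman_unique_solution P finA (fun theta => F_sub d theta d0)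
    (fun theta => X_meas d theta d0) (g_meas d d0) (fun x a => gG d x a d0) (delta_range d d0)).
(* [E] must exceed 1 for the choice of the level, and bound the initial error *)
pose E := 1 + G + G / (2 * u).
have Gu0 : 0 <= G / (2 * u) by rewrite divr_ge0// mulr_ge0// ltW.
have E1 : 1 <= E by rewrite /E -addrA lerDl addr_ge0.
have E0 : 0 < E by exact: lt_le_trans ltr01 E1.
have beta01 : 0 < 1 - u ^+ 2 < 1 by move: u0 u_half; nra.
have D1 : 1 <= 3 * M%:R :> R by rewrite -natrM ler1n muln_gt0.
have [N [c Nc]] := level_choice E1 beta01 D1.
exists N, c; split=> [eps /Nc[]//|d eps d0 eps01].
have [_ E_le D_le] := Nc eps eps01; have /andP[eps0 _] := eps01.
split.
  apply: (le_trans (cost_le (Rc_ge0 d d0) M_gt0 (fun n => C_rec d n d0) (N eps))).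
  by rewrite [leRHS]mulrAC [leRHS]mulrC ler_wpM2l// Rc_ge0.
apply: ge_ereal_sup => _ [x _ <-].
apply: (L2_error_le finA (fun theta => F_sub d theta d0) (F_indep d d0)
  (fun theta => X_meas d theta d0) (X_iid d d0) (g_meas d d0) (fun x a => gG d x a d0)
  (delta_range d d0) M_gt0 (fun n theta x a w => Qn_rec d n theta x a w d0)
  actionsP u0 u_half (delta_u d d0) u2E E0 _ _ x (Q_sol d d0) eps0 E_le).
  by rewrite /E; lra.
by rewrite /E; lra.
Qed.
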